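(* Consider the EC-LSVRG algorithm described in the context for the smooth problem $\min_x f(x)$ (i.e. $\psi=0$), where $Q$ and $Q_1$ are contraction compressors with parameters $\delta$ and $\delta_1$ respectively, each $f_i^{(\tau)}$ is $L$-smooth, each $f^{(\tau)}$ is $\bar L$-smooth, and $f$ is $L_f$-smooth and $\mu$-strongly convex. Put $\rho:=\min\{\frac{\mu\eta}{2},\frac{\delta}{4},\frac{\delta_1}{4},\frac p4\}$, $w_k:=(1-\rho)^{-k}$, $W_k:=\sum_{i=0}^k w_i$, $\bar x^k:=\frac1{W_k}\sum_{i=0}^k w_i x^i$, and $$\eta_{\max}:=\min\left\{\frac1{4L_f+33L/n},\ \frac{\delta}{60\sqrt{(1-\delta)L_f\bar L}},\ \frac{\sqrt\delta}{64\sqrt{(1-\delta)L_fL}},\ \frac{\delta\sqrt{\delta_1}}{120\sqrt{(1-\delta)L_f\bar Lp\big(1+\frac{2p}{\delta_1}\big)}}\right\},$$ $$\Delta_0:=9\mu\|x^0-x^*\|^2+2\big(f(x^0)-f(x^* )\big)+\frac1{15\bar Ln}\sum_{\tau=1}^n\|\nabla f^{(\tau)}(x^0)-h_\tau^0\|^2 .$$ (i) Let $\eta\le\eta_{\max}$. If $\mu>0$, then $$\mathbb{E}[f(\bar x^k)-f(x^* )]\le\frac{\Delta_0}{1-(1-\rho)^{k+1}}(1-\rho)^k .$$ If $\mu=0$, then $$\mathbb{E}[f(\bar x^k)-f(x^* )]\le\frac1{k+1}\left(\frac{18}\eta\|x^0-x^*\|^2+\frac1{3\bar Lpn}\sum_{\tau=1}^n\|\nabla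 f^{(\tau)}(x^0)-h_\tau^0\|^2+\frac6p\big(f(x^0)-f(x^* )\big)\right).$$ (ii) Let $\eta=\eta_{\max}$ and $p\le O(\delta_1)$. If $\mu>0$ and $\epsilon\le\Delta_0$, then $\mathbb{E}[f(\bar x^k)-f(x^* )]\le\epsilon$ as long as $$k\ge O\left(\left(\frac1\delta+\frac1p+\frac{L_f}\mu+\frac L{n\mu}+\frac{\sqrt{(1-\delta)L_f\bar L}}{\delta\mu}+\frac{\sqrt{(1-\delta)L_fL}}{\sqrt\delta\,\mu}\right)\ln\frac1\epsilon\right).$$ If $\mu=0$, then $\mathbb{E}[f(\bar x^k)-f(x^* )]\le\epsilon$ as long as $$k\ge O\left(\left(\frac1p+L_f+\frac Ln+\frac{\sqrt{(1-\delta)L_f\bar L}}\delta+\frac{\sqrt{(1-\delta)L_fL}}{\sqrt\delta}\right)\frac1\epsilon\right).$$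
   Context: Problem: $\min_{x\in\mathbb{R}^d}f(x)$, where $f=\frac1n\sum_{\tau=1}^n f^{(\tau)}$, $f^{(\tau)}=\frac1m\sum_{i=1}^m f_i^{(\tau)}$, and each $f_i^{(\tau)}:\mathbb{R}^d\to\mathbb{R}$ is convex and smooth; $x^*$ is an optimal solution (assumed to exist). $\|\cdot\|$ is the Euclidean norm. ''$L$-smooth'' means differentiable with $L$-Lipschitz gradient. ''$\mu$-strongly convex'' ($\mu\ge0$) means $f-\frac\mu2\|\cdot\|^2$ is convex. A possibly randomized map $Q:\mathbb{R}^d\to\mathbb{R}^d$ is a contraction compressor with parameter $\delta\in(0,1]$ if $\mathbb{E}\|x-Q(x)\|^2\le(1-\delta)\|x\|^2$ for all $x\in\mathbb{R}^d$. EC-LSVRG algorithm (case $\psi=0$). Parameters: stepsize $\eta>0$, probability $p\in(0,1]$. Initialization: $x^0=w^0\in\mathbb{R}^d$, $e_\tau^0=0$, $h_\tau^0\in\mathbb{R}^d$ for $1\le\tau\le n$, $h^0=\frac1n\sum_\tau h_\tau^0$. For $k=0,1,2,\dots$: for each $\tau$, sample $i_k^\tau$ uniformly and independently from $\{1,\dots,m\}$ and set $g_\tau^k=\nabla f^{(\tau)}_{i_k^\tau}(x^k)-\nabla f^{(\tau)}_{i_k^\tau}(w^k)+\nabla f^{(\tau)}(w^k)-h_\tau^k$, $\;y_\tau^k=Q(\eta g_\tau^k+e_\tau^k)$, $\;e_\tau^{k+1}=e_\tau^k+\eta g_\tau^k-y_\tau^k$, $\;z_\tau^k=Q_1(\nabla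 f^{(\tau)}(w^k)-h_\tau^k)$, $\;h_\tau^{k+1}=h_\tau^k+z_\tau^k$. Then $y^k=\frac1n\sum_\tau y_\tau^k$, $z^k=\frac1n\sum_\tau z_\tau^k$, $x^{k+1}=x^k-(y^k+\eta h^k)$; $w^{k+1}=x^k$ with probability $p$ and $w^{k+1}=w^k$ with probability $1-p$; $h^{k+1}=h^k+z^k$. *)

(* Defs.v *)
From HB Require Import structures.
From mathcomp Require Import all_boot all_order all_algebra.
From mathcomp Require Import all_classical all_reals all_analysis.
Set Implicit Arguments.
Unset Strict Implicit.
Unset Printing Implicit Defensive.
Import Order.TTheory GRing.Theory Num.Theory.
Import numFieldNormedType.Exports.
Local Open Scope classical_set_scope.
Local Open Scope ring_scope.

(* The norm of MathComp-Analysis on 'rV[R]_d is the sup norm. It induces the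
   same topology, hence the same notion of differentiability, but every metric
   statement below is about the Euclidean norm. *)
Definition enorm (R : realType) (d : nat) (x : 'rV[R]_d) : R :=
  Num.sqrt (\sum_(j < d) x ord0 j ^+ 2).

Definition grad (R : realType) (d : nat) (f : 'rV[R]_d -> R) (x : 'rV[R]_d) :
    'rV[R]_d :=
  \row_(j < d) 'D_(delta_mx ord0 j) f x.

Definition smooth (R : realType) (d : nat) (L : R) (f : 'rV[R]_d -> R) : Prop :=
  (forall x, differentiable f x) /\
  (forall x y, enorm (grad f x - grad f y) <= L * enorm (x - y)).

Definition convexV (R : realType) (d : nat) (f : 'rV[R]_d -> R) : Prop :=
  convex_function (E := 'rV[R]_d) setT f.

Definition strongly_convex (R : realType) (d : nat) (mu : R)
    (f : 'rV[R]_d -> R) : Prop :=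
  convexV (fun x => f x - mu / 2 * enorm x ^+ 2).

Definition avg (R : realType) (V : lmodType R) (n : nat) (u : 'I_n -> V) : V :=
  n%:R^-1 *: \sum_(t < n) u t.

Definition node_obj (R : realType) (d n m : nat)
    (fi : 'I_n -> 'I_m -> 'rV[R]_d -> R) (t : 'I_n) (x : 'rV[R]_d) : R :=
  m%:R^-1 * \sum_(i < m) fi t i x.

Definition objective (R : realType) (d n m : nat)
    (fi : 'I_n -> 'I_m -> 'rV[R]_d -> R) (x : 'rV[R]_d) : R :=
  n%:R^-1 * \sum_(t < n) node_obj fi t x.

Record problem (R : realType) := Problem {
  dimension : nat;
  nodes : nat;
  items : nat;
  nodes_gt0 : (0 < nodes)%N;
  items_gt0 : (0 < items)%N;
  fi : 'I_nodes -> 'I_items -> 'rV[R]_dimension -> R;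
  L_item : R;
  L_node : R;
  L_obj : R;
  mu : R;
  xstar : 'rV[R]_dimension;
  L_item_gt0 : 0 < L_item;
  L_node_gt0 : 0 < L_node;
  L_obj_gt0 : 0 < L_obj;
  mu_ge0 : 0 <= mu;
  fi_convex : forall t i, convexV (fi t i);
  fi_smooth : forall t i, smooth L_item (fi t i);
  node_smooth : forall t, smooth L_node (node_obj fi t);
  obj_smooth : smooth L_obj (objective fi);
  obj_strongly_convex : strongly_convex mu (objective fi);
  xstar_min : forall x, objective fi xstar <= objective fi x
}.

Definition borelV (R : realType) (d : nat) :=
  g_sigma_algebraType (@open 'rV[R]_d).

(* A randomized map is a map Q with an extra argument, a seed of law nu; a
   deterministic map is the case of a one-point seed space. Joint measurability
   makes Q at a random point, with a random seed, a random vector. *)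
Definition contraction_compressor (R : realType) (d : nat) (delta : R)
    (disp : measure_display) (S : measurableType disp) (nu : probability S R)
    (Q : S -> 'rV[R]_d -> 'rV[R]_d) : Prop :=
  [/\ 0 < delta <= 1,
      measurable_fun setT (fun z : S * borelV R d => Q z.1 z.2 : borelV R d) &
      forall x : 'rV[R]_d,
        ('E_nu[fun s => (enorm (x - Q s x) ^+ 2)%R]
           <= ((1 - delta) * enorm x ^+ 2)%:E)%E].

(* Mutual independence of a family of sets of events (here sigma-algebras). *)
Definition mutually_independent (R : realType) (disp : measure_display)
    (T : measurableType disp) (P : probability T R) (I : choiceType)
    (G : I -> set (set T)) : Prop :=
  forall (J : seq I) (A : I -> set T), uniq J ->
    (forall i, i \in J -> G i (A i)) ->
    P (\bigcap_(i in [set` J]) A i) = (\prod_(i <- J) P (A i))%E.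

(* The sources of randomness: [inl (inl (k, t))] is the draw of the index of
   node t at iteration k, [inl (inr k)] is all the compression done at
   iteration k, [inr k] is the coin deciding w^(k+1). Grouping the seeds of an
   iteration makes the compressors independent of everything else while leaving
   the dependence between nodes, and between Q and Q1, arbitrary. *)
Definition source (n : nat) : choiceType := ((nat * 'I_n) + nat + nat)%type.

Definition source_events (n m : nat) (T S S1 : Type)
    (mS : set (set S)) (mS1 : set (set S1))
    (idx : nat -> 'I_n -> T -> 'I_m)
    (seed : nat -> 'I_n -> T -> S) (seed1 : nat -> 'I_n -> T -> S1)
    (coin : nat -> T -> bool) (s : source n) : set (set T) :=
  match s with
  | inl (inl (k, t)) => [set idx k t @^-1` A | A in [set: set 'I_m]]
  | inl (inr k) =>
      <<s \bigcup_(t in [set: 'I_n])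
            ([set seed k t @^-1` A | A in mS] `|`
             [set seed1 k t @^-1` A | A in mS1]) >>
  | inr k => [set coin k @^-1` A | A in [set: set bool]]
  end.

Record ec_lsvrg (R : realType) (pb : problem R) := EcLsvrg {
  stepsize : R;
  p_coin : R;
  delta : R;
  delta1 : R;
  x0 : 'rV[R]_(dimension pb);
  h0 : 'I_(nodes pb) -> 'rV[R]_(dimension pb);
  dispS : measure_display;
  Seed : measurableType dispS;
  nu : probability Seed R;
  Q : Seed -> 'rV[R]_(dimension pb) -> 'rV[R]_(dimension pb);
  dispS1 : measure_display;
  Seed1 : measurableType dispS1;
  nu1 : probability Seed1 R;
  Q1 : Seed1 -> 'rV[R]_(dimension pb) -> 'rV[R]_(dimension pb);
  dispT : measure_display;
  Omega : measurableType dispT;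
  Pr : probability Omega R;
  idx : nat -> 'I_(nodes pb) -> Omega -> 'I_(items pb);
  seed : nat -> 'I_(nodes pb) -> Omega -> Seed;
  seed1 : nat -> 'I_(nodes pb) -> Omega -> Seed1;
  coin : nat -> Omega -> bool;
  stepsize_gt0 : 0 < stepsize;
  p_coin_range : 0 < p_coin <= 1;
  Q_compressor : contraction_compressor delta nu Q;
  Q1_compressor : contraction_compressor delta1 nu1 Q1;
  idx_meas : forall k t i, measurable (idx k t @^-1` [set i]);
  idx_law : forall k t i,
    Pr (idx k t @^-1` [set i]) = ((items pb)%:R^-1)%:E;
  seed_meas : forall k t, measurable_fun setT (seed k t);
  seed_law : forall k t A, measurable A -> Pr (seed k t @^-1` A) = nu A;
  seed1_meas : forall k t, measurable_fun setT (seed1 k t);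
  seed1_law : forall k t A, measurable A -> Pr (seed1 k t @^-1` A) = nu1 A;
  coin_meas : forall k, measurable_fun setT (coin k);
  coin_law : forall k, Pr (coin k @^-1` [set true]) = p_coin%:E;
  sources_indep : mutually_independent Pr
    (source_events measurable measurable idx seed seed1 coin)
}.

Record state (R : realType) (d n : nat) := State {
  st_x : 'rV[R]_d;
  st_w : 'rV[R]_d;
  st_e : 'I_n -> 'rV[R]_d;
  st_hloc : 'I_n -> 'rV[R]_d;
  st_h : 'rV[R]_d
}.

Definition init_state (R : realType) (pb : problem R) (a : ec_lsvrg pb) :
    state R (dimension pb) (nodes pb) :=
  State (x0 a) (x0 a) (fun _ => 0) (h0 a) (avg (h0 a)).

Definition step (R : realType) (pb : problem R) (a : ec_lsvrg pb) (k : nat)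
    (om : Omega a) (s : state R (dimension pb) (nodes pb)) :
    state R (dimension pb) (nodes pb) :=
  let: State x w e hl h := s in
  let f_t := node_obj (@fi R pb) in
  let g t := grad (fi t (idx k t om)) x - grad (fi t (idx k t om)) w
             + grad (f_t t) w - hl t in
  let y t := Q (seed k t om) (stepsize a *: g t + e t) in
  let z t := Q1 (seed1 k t om) (grad (f_t t) w - hl t) in
  State (x - (avg y + stepsize a *: h))
        (if coin k om then x else w)
        (fun t => e t + stepsize a *: g t - y t)
        (fun t => hl t + z t)
        (h + avg z).

Fixpoint run (R : realType) (pb : problem R) (a : ec_lsvrg pb) (k : nat)
    (om : Omega a) : state R (dimension pb) (nodes pb) :=
  if k is k'.+1 then step k' om (run k' om) else init_state a.

Definition iterate (R : realType) (pb : problem R) (a : ec_lsvrg pb)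
    (k : nat) (om : Omega a) : 'rV[R]_(dimension pb) := st_x (run k om).

Definition rho (R : realType) (pb : problem R) (a : ec_lsvrg pb) : R :=
  Num.min (mu pb * stepsize a / 2)
    (Num.min (delta a / 4) (Num.min (delta1 a / 4) (p_coin a / 4))).

Definition weight (R : realType) (pb : problem R) (a : ec_lsvrg pb)
    (k : nat) : R := (1 - rho a) ^- k.

Definition total_weight (R : realType) (pb : problem R) (a : ec_lsvrg pb)
    (k : nat) : R := \sum_(i < k.+1) weight a i.

Definition xbar (R : realType) (pb : problem R) (a : ec_lsvrg pb) (k : nat)
    (om : Omega a) : 'rV[R]_(dimension pb) :=
  (total_weight a k)^-1 *: \sum_(i < k.+1) weight a i *: iterate i om.

Definition expected_gap (R : realType) (pb : problem R) (a : ec_lsvrg pb)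
    (k : nat) : \bar R :=
  'E_(Pr a)[fun om => (objective (@fi R pb) (xbar k om)
                     - objective (@fi R pb) (xstar pb))%R].

(* Extended-real valued because the last three terms are +oo when delta = 1
   (the inverse of 0 in \bar R is +oo). *)
Definition eta_max (R : realType) (pb : problem R) (a : ec_lsvrg pb) : \bar R :=
  let n : R := (nodes pb)%:R in
  let: (de, de1) := (delta a, delta1 a) in
  let: (l, lb, lf) := (L_item pb, L_node pb, L_obj pb) in
  Order.min (1%:E / (4 * lf + 33 * l / n)%:E)%E
 (Order.min (de%:E / (60 * Num.sqrt ((1 - de) * lf * lb))%:E)%E
 (Order.min ((Num.sqrt de)%:E / (64 * Num.sqrt ((1 - de) * lf * l))%:E)%E
   ((de * Num.sqrt de1)%:E /
     (120 * Num.sqrt ((1 - de) * lf * lb * p_coin a * (1 + 2 * p_coin a / de1)))%:E)%E)).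

Definition init_dist (R : realType) (pb : problem R) (a : ec_lsvrg pb) : R :=
  enorm (x0 a - xstar pb) ^+ 2.

Definition init_gap (R : realType) (pb : problem R) (a : ec_lsvrg pb) : R :=
  objective (@fi R pb) (x0 a) - objective (@fi R pb) (xstar pb).

Definition init_shift (R : realType) (pb : problem R) (a : ec_lsvrg pb) : R :=
  \sum_(t < nodes pb)
    enorm (grad (node_obj (@fi R pb) t) (x0 a) - h0 a t) ^+ 2.

Definition Delta0 (R : realType) (pb : problem R) (a : ec_lsvrg pb) : R :=
  9 * mu pb * init_dist a + 2 * init_gap a
  + 1 / (15 * L_node pb * (nodes pb)%:R) * init_shift a.

(* The factors of ln (1/epsilon) (strongly convex case) and of 1/epsilon (merely
   convex case) in the iteration complexities. *)
Definition rate_sc (R : realType) (pb : problem R) (a : ec_lsvrg pb) : R :=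
  (delta a)^-1 + (p_coin a)^-1 + L_obj pb / mu pb + L_item pb / ((nodes pb)%:R * mu pb)
  + Num.sqrt ((1 - delta a) * L_obj pb * L_node pb) / (delta a * mu pb)
  + Num.sqrt ((1 - delta a) * L_obj pb * L_item pb) / (Num.sqrt (delta a) * mu pb).

Definition rate_c (R : realType) (pb : problem R) (a : ec_lsvrg pb) : R :=
  (p_coin a)^-1 + L_obj pb + L_item pb / (nodes pb)%:R
  + Num.sqrt ((1 - delta a) * L_obj pb * L_node pb) / delta a
  + Num.sqrt ((1 - delta a) * L_obj pb * L_item pb) / Num.sqrt (delta a).

(* Main.v *)
(* Error compensation is analysed along the virtual point [x - e], with [e] the
   mean of the local errors: its increments are [- eta] times an unbiased
   estimate of the gradient at [x], so the usual descent computation applies up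
   to a multiple of the mean squared error.  The squared errors, the squared
   distances of the shifts [h] to the local gradients at the reference point [w],
   and the optimality gap at [w] obey linear recursions with contraction factors
   [1 - delta/2], [1 - delta1/2] and [1 - p], forced by the optimality gaps at
   [x] and [w] through cocoercivity of the gradients.  A suitable positive
   combination of the four quantities contracts by [1 - rho] while releasing
   [eta/2] times the gap at [x]; telescoping and Jensen's inequality give the
   rates.  The conditional expectations are replaced by Fubini's theorem on the
   product of the sigma-algebra of past draws with the law of a fresh one. *)
Require Import Defs.
From HB Require Import structures.
From mathcomp Require Import all_boot all_order all_algebra.
From mathcomp Require Import all_classical all_reals all_analysis.
From mathcomp Require Import measurable_realfun ring lra.
Import Order.TTheory GRing.Theory Num.Theory.
Import numFieldNormedType.Exports.
Local Open Scope classical_set_scope.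
Local Open Scope ring_scope.

Set Implicit Arguments.
Unset Strict Implicit.

(** * Euclidean geometry and gradient inequalities *)

Section dot.
Context {R : realType} {d : nat}.
Implicit Types (u v x y : 'rV[R]_d).

(** A compressor is bounded only in mean, so square integrability of the iterates cannot be read off
    a pathwise bound: it is established together with measurability, by induction on the iterations.
    The predicate [sq l V] carries both, [l] listing sources from which [V] is known. Within an
    iteration the order is index draws, compression, coin, and each is fresh for what precedes it.
    The noise of the index draws is uncorrelated with the past and across nodes. Splitting it off
    exactly, before any use of Young's inequality, yields the [L / n] and the mere [sqrt delta] in
    front of [L] in the stepsize. Convexity supplies [3 / 2 * eta] times the gap at the iterate. The
    feedback through the recursions may consume [eta] of it, and the four entries of [eta_max] keep
    it within this budget, leaving [eta / 2]. *)

Definition dot u v : R := \sum_(j < d) u ord0 j * v ord0 j.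

Lemma dotC u v : dot u v = dot v u.
Proof. by apply: eq_bigr => j _; rewrite mulrC. Qed.

Lemma dotDl u v x : dot (u + v) x = dot u x + dot v x.
Proof. by rewrite -big_split; apply: eq_bigr => j _; rewrite mxE mulrDl. Qed.

Lemma dotZl a u v : dot (a *: u) v = a * dot u v.
Proof. by rewrite mulr_sumr; apply: eq_bigr => j _; rewrite mxE mulrA. Qed.

Lemma dotNl u v : dot (- u) v = - dot u v.
Proof. by rewrite -scaleN1r dotZl mulN1r. Qed.

Lemma dotDr u v x : dot x (u + v) = dot x u + dot x v.
Proof. by rewrite dotC dotDl !(dotC x). Qed.

Lemma dotZr a u v : dot u (a *: v) = a * dot u v.
Proof. by rewrite dotC dotZl dotC. Qed.

Lemma dotNr u v : dot u (- v) = - dot u v.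
Proof. by rewrite dotC dotNl dotC. Qed.

Lemma dot0l u : dot 0 u = 0.
Proof. by rewrite -(scale0r 0) dotZl mul0r. Qed.

Lemma dot0r u : dot u 0 = 0.
Proof. by rewrite dotC dot0l. Qed.

Lemma dot_suml (I : finType) (F : I -> 'rV[R]_d) v :
  dot (\sum_i F i) v = \sum_i dot (F i) v.
Proof.
by apply: (big_ind2 (fun a b => dot a v = b)); rewrite ?dot0l// => a b a' b' <- <-; rewrite dotDl.
Qed.

Lemma dot_sumr (I : finType) (F : I -> 'rV[R]_d) v :
  dot v (\sum_i F i) = \sum_i dot v (F i).
Proof. by rewrite dotC dot_suml; apply: eq_bigr => i _; rewrite dotC. Qed.

Definition dotE := (dotDl, dotDr, dotNl, dotNr, dotZl, dotZr).

Lemma dot_ge0 u : 0 <= dot u u.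
Proof. by apply: sumr_ge0 => j _; rewrite -expr2 sqr_ge0. Qed.

Lemma enorm_sqr u : enorm u ^+ 2 = dot u u.
Proof.
rewrite sqr_sqrtr; last by apply: sumr_ge0 => j _; exact: sqr_ge0.
by apply: eq_bigr => j _; rewrite expr2.
Qed.

Lemma enorm_ge0 u : 0 <= enorm u.
Proof. exact: sqrtr_ge0. Qed.

(** Nonnegativity of the square of [c *: u - v], divided by [c]. *)
Lemma dot_young c u v : 0 < c -> 2 * dot u v <= c * dot u u + c^-1 * dot v v.
Proof.
move=> c0; have := dot_ge0 (c *: u - v).
have -> : c * dot u u + c^-1 * dot v v = c^-1 * (c ^+ 2 * dot u u + dot v v) by field; rewrite gt_eqF.
rewrite ler_pdivlMl// !dotE (dotC v u); nra.
Qed.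

Lemma dot_enorm u v : dot u v <= enorm u * enorm v.
Proof.
have [u0|u0] := eqVneq (enorm u) 0.
  have dz : dot u u = 0 by rewrite -enorm_sqr u0 expr0n.
  have uz j : u ord0 j = 0.
    apply/eqP; rewrite -sqrf_eq0 expr2; apply/eqP; move: j isT.
    by apply/psumr_eq0P => // i _; rewrite -expr2 sqr_ge0.
  by rewrite u0 mul0r /dot big1// => j _; rewrite uz mul0r.
have up : 0 < enorm u by rewrite lt_def u0 enorm_ge0.
have [v0|v0] := eqVneq (enorm v) 0.
  have dz : dot v v = 0 by rewrite -enorm_sqr v0 expr0n.
  have vz j : v ord0 j = 0.
    apply/eqP; rewrite -sqrf_eq0 expr2; apply/eqP; move: j isT.
    by apply/psumr_eq0P => // i _; rewrite -expr2 sqr_ge0.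
  by rewrite v0 mulr0 /dot big1// => j _; rewrite vz mulr0.
have vp : 0 < enorm v by rewrite lt_def v0 enorm_ge0.
(* The weight [enorm v / enorm u] equalises the two terms of Young's inequality, which turns it into
   Cauchy-Schwarz. *)
have := dot_young u v (divr_gt0 vp up); rewrite -!enorm_sqr.
rewrite (_ : _ + _ = 2 * (enorm u * enorm v)) ?ler_pM2l//.
by field; rewrite u0.
Qed.

Lemma dot_split (c : R) u v : 0 < c ->
  dot (u + v) (u + v) <= (1 + c) * dot u u + (1 + c^-1) * dot v v.
Proof. by move=> c0; have := dot_young u v c0; rewrite !dotE (dotC v u); lra. Qed.

Lemma dot_add_le u v : dot (u + v) (u + v) <= 2 * dot u u + 2 * dot v v.
Proof. by have := dot_split u v ltr01; rewrite invr1. Qed.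

End dot.

(** Bias-variance identity: the sum of the [F t] is [n] times the mean, so the cross terms collapse.
    It gives both Jensen's inequality for squares and the bound of sampling noise by a second
    moment. *)
Lemma avg_variance {R : realType} {d n : nat} (F : 'I_n -> 'rV[R]_d) :
  (0 < n)%N ->
  n%:R^-1 * \sum_t dot (F t - avg F) (F t - avg F)
    = n%:R^-1 * \sum_t dot (F t) (F t) - dot (avg F) (avg F).
Proof.
move=> n0; have n0' : n%:R != 0 :> R by rewrite pnatr_eq0 -lt0n.
have : \sum_i F i = n%:R *: avg F by rewrite scalerA divff ?scale1r.
move: (avg F) => a sF.
have -> : \sum_t dot (F t - a) (F t - a)
    = \sum_t (dot (F t) (F t) - 2 * dot (F t) a + dot a a).
  by apply: eq_bigr => t _; rewrite !dotE (dotC a); ring.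
rewrite big_split/= sumrB -mulr_sumr -dot_suml sumr_const card_ord -mulr_natl.
by rewrite sF dotZl; field.
Qed.

Lemma avg_dot_le {R : realType} {d n : nat} (F : 'I_n -> 'rV[R]_d) : (0 < n)%N ->
  dot (avg F) (avg F) <= n%:R^-1 * \sum_t dot (F t) (F t).
Proof.
move=> n0; rewrite -subr_ge0 -avg_variance// mulr_ge0 ?invr_ge0 ?ler0n//.
by apply: sumr_ge0 => t _; exact: dot_ge0.
Qed.

Section avg.
Context {R : realType} {V : lmodType R} {n : nat}.

Lemma avgD (F G : 'I_n -> V) : avg F + avg G = avg (fun t => F t + G t).
Proof. by rewrite /avg -scalerDr big_split. Qed.

Lemma avgN (F : 'I_n -> V) : - avg F = avg (fun t => - F t).
Proof. by rewrite /avg -scalerN sumrN. Qed.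

Lemma avgZ c (F : 'I_n -> V) : c *: avg F = avg (fun t => c *: F t).
Proof. by rewrite /avg -scaler_sumr !scalerA mulrC. Qed.

End avg.

(** * First-order inequalities for convex and smooth functions *)

Section gradient.
Context {R : realType} {d : nat}.
Implicit Types (f : 'rV[R]_d -> R) (x y v : 'rV[R]_d).

Lemma derive_grad f x v : differentiable f x -> 'D_v f x = dot (grad f x) v.
Proof.
move=> df; rewrite deriveE// {1}(row_sum_delta v) linear_sum.
by apply: eq_bigr => j _; rewrite linearZ/= mxE deriveE// mulrC.
Qed.

Lemma is_derive_line f x v (t : R) : differentiable f (x + t *: v) ->
  is_derive t 1 (fun s : R => f (x + s *: v)) (dot (grad f (x + t *: v)) v).
Proof.
move=> df; have dv : derivable f (x + t *: v) v by exact: diff_derivable.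
rewrite -derive_grad//.
have E : (fun h : R => h^-1 *: (f (h *: v + (x + t *: v)) - f (x + t *: v)))
   = (fun h : R => h^-1 *: (f (x + (h *: 1 + t) *: v) - f (x + t *: v))).
  by apply/funext => h; rewrite [h *: 1]mulr1 scalerDl addrCA.
apply: DeriveDef; first by rewrite /derivable /= -E; exact: dv.
by rewrite /derive /= -E.
Qed.

(** Difference quotients at [0] from the right are nonpositive, hence so is their limit. This turns
    a chord inequality into a tangent inequality. *)
Lemma derive_le0_of_le0 (h : R -> R) (l : R) : is_derive (0 : R) (1 : R) h l -> h 0 = 0 ->
  (forall t, 0 < t < 1 -> h t <= 0) -> l <= 0.
Proof.
move=> [dh <-] h0 hle; rewrite /derive.
have cl := dh; rewrite /derivable /= in cl.
have /cvg_dnbhs_at_right cr := cl.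
apply: (cvgr_to_le cr).
near=> t.
have t0 : 0 < t by near: t; exact: nbhs_right_gt.
have t1 : t < 1 by near: t; exact: nbhs_right_lt.
rewrite h0 subr0 addr0 [t *: 1]mulr1 /=.
by rewrite pmulr_rle0 ?invr_gt0//; apply: hle; rewrite t0.
Unshelve. all: by end_near. Qed.

Lemma strongly_convex_grad m f : (forall x, differentiable f x) ->
  strongly_convex m f -> forall x y,
  f x + dot (grad f x) (y - x) + m / 2 * dot (y - x) (y - x) <= f y.
Proof.
move=> df cf x y; set v := y - x.
(* Excess of [f] over the strongly convex chord bound, whose defect is [t * (1 - t)]. It vanishes at
   [0] and is nonpositive on the unit interval; its derivative at [0] is the claim. *)
pose h (t : R) : R := f (x + t *: v) - ((1 - t) * f x + t * f y - m / 2 * (t * (1 - t)) * dot v v).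
have hd : is_derive (0 : R) (1 : R) h (dot (grad f x) v - (f y - f x - m / 2 * dot v v)).
  have d1 := @is_derive_line f x v 0 (df _); rewrite scale0r addr0 in d1.
  have E : h = (fun s : R => f (x + s *: v)) \- (fun t : R => (1 - t) * f x + t * f y - m / 2 * (t * (1 - t)) * dot v v) by [].
  rewrite E; apply: is_deriveB.
  apply: is_derive_eq.
  rewrite /GRing.scale/=; ring.
suff: dot (grad f x) v - (f y - f x - m / 2 * dot v v) <= 0 by lra.
apply: (derive_le0_of_le0 hd) => [|t /andP[t0 t1]].
  by rewrite /h scale0r addr0; ring.
have : f (t *: y + (1 - t) *: x) - m / 2 * enorm (t *: y + (1 - t) *: x) ^+ 2
    <= t * (f y - m / 2 * enorm y ^+ 2) + (1 - t) * (f x - m / 2 * enorm x ^+ 2).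
  exact: (cf (Itv01 (ltW t0) (ltW t1)) y x (mem_setT _) (mem_setT _)).
rewrite !enorm_sqr.
have -> : t *: y + (1 - t) *: x = x + t *: v.
  by rewrite /v scalerBl scale1r scalerBr addrCA.
rewrite /h /v !dotE (dotC y x); lra.
Qed.

Lemma convex_grad f : (forall x, differentiable f x) -> convexV f ->
  forall x y, f x + dot (grad f x) (y - x) <= f y.
Proof.
move=> df cf x y; have sc : strongly_convex 0 f.
  rewrite /strongly_convex (_ : (fun _ => _) = f)//.
  by apply/funext => z; rewrite !mul0r subr0.
by have := strongly_convex_grad df sc x y; rewrite !mul0r addr0.
Qed.

(** Descent lemma. Along the segment, [f] minus its quadratic majorant has nonpositive derivative,
    by Cauchy-Schwarz and the Lipschitz gradient, so no integral of the gradient is involved. *)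
Lemma smooth_le L f : smooth L f -> forall x y,
  f y <= f x + dot (grad f x) (y - x) + L / 2 * dot (y - x) (y - x).
Proof.
move=> [df lf] x y; set v := y - x.
pose h (t : R) : R := f (x + t *: v) - (t * dot (grad f x) v + L / 2 * t ^+ 2 * dot v v).
have hd t : is_derive (t : R) (1 : R) h (dot (grad f (x + t *: v) - grad f x) v - L * t * dot v v).
  have E : h = (fun s : R => f (x + s *: v)) \- (fun t : R => t * dot (grad f x) v + L / 2 * t ^+ 2 * dot v v) by [].
  have d1 := is_derive_line (df (x + t *: v)).
  rewrite E; apply: is_derive_eq.
  by rewrite /GRing.scale/= dotDl dotNl; field.
have h0 : h 0 = f x by rewrite /h scale0r addr0; ring.
have h1 : h 1 = f y - (dot (grad f x) v + L / 2 * dot v v).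
  by rewrite /h scale1r /v (addrC x) subrK; ring.
suff : h 1 <= h 0 by rewrite h0 h1; lra.
have cont : {within `[0, 1], continuous h}.
  by apply: derivable_within_continuous => z _; have [] := hd z.
have dh (t : R) : t \in `]0, 1[ -> derivable h t 1 by move=> _; have [] := hd t.
suff dh0 (t : R) : t \in `]0, 1[ -> derive1 h t <= 0.
  by apply: (ler0_derive1_le_cc dh dh0 cont); rewrite ?in_itv/= ?lexx ?ler01.
rewrite in_itv/= => /andP[t0 t1].
rewrite derive1E; have [_ ->] := hd t; rewrite subr_le0.
have [v0|v0] := eqVneq (dot v v) 0.
  have := dot_enorm (grad f (x + t *: v) - grad f x) v.
  have -> : enorm v = 0 by apply/eqP; rewrite -sqrf_eq0 enorm_sqr v0.
  by rewrite v0 !mulr0.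
have := dot_enorm (grad f (x + t *: v) - grad f x) v => /le_trans; apply.
have := lf (x + t *: v) x; rewrite addrAC subrr add0r => lft.
apply: (le_trans (ler_wpM2r (enorm_ge0 _) lft)).
have -> : enorm (t *: v) = t * enorm v.
  apply/eqP; rewrite -(@eqrXn2 _ 2)// ?enorm_ge0// ?mulr_ge0 ?enorm_ge0 ?ltW//.
  by rewrite exprMn !enorm_sqr !dotE; apply/eqP; ring.
by rewrite -enorm_sqr; lra.
Qed.

(** Cocoercivity: at the point [x - L^-1 *: g] the tangent at [y] bounds [f] below and the descent
    lemma at [x] bounds it above. Convexity is assumed in tangent form, the form that averages
    inherit from their members. *)
Lemma smooth_convex_grad L f : 0 < L -> smooth L f ->
  (forall x y, f x + dot (grad f x) (y - x) <= f y) -> forall x y,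
  dot (grad f x - grad f y) (grad f x - grad f y)
    <= 2 * L * (f x - f y - dot (grad f y) (x - y)).
Proof.
move=> L0 sf cf x y; set g := grad f x - grad f y.
have := smooth_le sf x (x - L^-1 *: g); have := cf y (x - L^-1 *: g).
have -> : x - L^-1 *: g - x = - (L^-1 *: g) by rewrite addrAC subrr add0r.
have -> : x - L^-1 *: g - y = x - y - L^-1 *: g by rewrite addrAC.
rewrite dotDr !dotNr dotNl !dotZr dotZl opprK => h1 h2.
have E : dot (grad f x) g - dot (grad f y) g = dot g g by rewrite -dotNl -dotDl.
have Li : L * L^-1 = 1 by rewrite divff// gt_eqF.
have h3 := le_trans h1 h2.
have : L^-1 * dot g g - L / 2 * (L^-1 * (L^-1 * dot g g)) <= f x - f y - dot (grad f y) (x - y).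
  by move: h3; set q := L / 2 * _; rewrite -E; lra.
have -> : L^-1 * dot g g - L / 2 * (L^-1 * (L^-1 * dot g g)) = (2 * L)^-1 * dot g g.
  by field; rewrite gt_eqF.
by rewrite ler_pdivrMl ?mulr_gt0.
Qed.

(** A step of length [L^-1] along the negative gradient would decrease [f] by at least [(2 * L)^-1]
    times the squared gradient. *)
Lemma grad_min L f xs : 0 < L -> smooth L f -> (forall x, f xs <= f x) ->
  grad f xs = 0.
Proof.
move=> L0 sf mf; set g := grad f xs.
have := smooth_le sf xs (xs - L^-1 *: g); have := mf (xs - L^-1 *: g).
have -> : xs - L^-1 *: g - xs = - (L^-1 *: g) by rewrite addrAC subrr add0r.
rewrite !dotNr dotNl !dotZr dotZl opprK -/g => h1 h2.
have : (2 * L)^-1 * dot g g <= 0.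
  have -> : (2 * L)^-1 * dot g g = L^-1 * dot g g - L / 2 * (L^-1 * (L^-1 * dot g g)).
    by field; rewrite gt_eqF.
  by have := le_trans h1 h2; lra.
rewrite pmulr_rle0 ?invr_gt0 ?mulr_gt0// => g0.
have {}g0 : dot g g = 0 by apply/eqP; rewrite eq_le g0 dot_ge0.
apply/rowP => j; rewrite [RHS]mxE; apply/eqP; rewrite -sqrf_eq0 expr2; apply/eqP.
by move: j isT; apply/psumr_eq0P => // i _; rewrite -expr2 sqr_ge0.
Qed.

Lemma grad_scale_sum n (c : R) (F : 'I_n -> 'rV[R]_d -> R) x :
  (forall t, differentiable (F t) x) ->
  grad (fun x => c * \sum_(t < n) F t x) x = c *: \sum_(t < n) grad (F t) x.
Proof.
move=> dF; apply/rowP => j; rewrite mxE [RHS]mxE summxE.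
set v := delta_mx _ _.
have dv t : is_derive x v (F t) (grad (F t) x ord0 j).
  by rewrite mxE; apply: derivableP; exact: diff_derivable.
have -> : (fun x => c * \sum_(t < n) F t x) = c *: (\sum_(i < n) F i).
  by apply/funext => y; rewrite /GRing.scale/= fct_sumE.
by have [_ ->] := is_deriveZ c (is_derive_sum dv).
Qed.

End gradient.

Section gradient_families.
Context {R : realType} {d : nat} {J : finType}.

(** Both gradients are compared with the one at [xs]. The factor 4 is 2 from splitting the square
    times 2 from cocoercivity. The index type [J] is generic so as to serve for nodes and for pairs
    of a node and an item. *)
Lemma sum_grad_dist_le (L c : R) (F : J -> 'rV[R]_d -> R) (f : 'rV[R]_d -> R) xs :
  0 < L -> 0 <= c -> (forall j, smooth L (F j)) ->
  (forall j x y, F j x + dot (grad (F j) x) (y - x) <= F j y) ->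
  (forall x, f x = c * \sum_j F j x) -> c *: \sum_j grad (F j) xs = 0 ->
  forall x y,
  c * \sum_j dot (grad (F j) x - grad (F j) y) (grad (F j) x - grad (F j) y)
    <= 4 * L * (f x - f xs + (f y - f xs)).
Proof.
move=> L0 c0 sF cF fE g0 x y.
(* The gradients of the members need not vanish at [xs], but their weighted sum does; hence the
   Bregman divergences from [xs] add up to the gap. *)
have dev z : f z - f xs = c * \sum_j (F j z - F j xs - dot (grad (F j) xs) (z - xs)).
  rewrite sumrB -dot_suml mulrBr -dotZl g0 dot0l subr0.
  by rewrite sumrB mulrBr -!fE.
rewrite !dev -mulrDr mulrCA -big_split/= ler_wpM2l// mulr_sumr ler_sum// => j _.
have := dot_add_le (grad (F j) x - grad (F j) xs) (- (grad (F j) y - grad (F j) xs)).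
rewrite opprB addrA subrK => /le_trans; apply.
have := smooth_convex_grad L0 (sF j) (cF j) x xs.
have := smooth_convex_grad L0 (sF j) (cF j) y xs.
rewrite -(opprB (grad (F j) y)) dotNl dotNr opprK; lra.
Qed.

End gradient_families.

(** * Measurable vectors and expectations *)

Section measurable_vectors.
Context {R : realType} {d : nat}.

Lemma measurable_continuous (f : 'rV[R]_d -> R) :
  continuous f -> measurable_fun setT (f : borelV R d -> R).
Proof.
move=> /continuousP cf; apply: (measurability _ (RGenOpens.measurableE R)).
move=> _ [_ [a [b ->] <-]]; rewrite setTI.
by apply: sub_sigma_algebra; apply: cf; exact: interval_open.
Qed.

Lemma measurable_coord j :
  measurable_fun setT ((fun x => x ord0 j) : borelV R d -> R).
Proof. by apply: measurable_continuous => x; exact: coord_continuous. Qed.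

(** Second countability: an open set is the union of the balls with rational centre and radius
    [1 / (k + 1)] that it contains, and a sup-norm ball is a finite intersection of conditions on
    single coordinates. *)
Lemma measurable_rV d' (T : measurableType d') (V : T -> 'rV[R]_d) :
  (forall j, measurable_fun setT (fun w => V w ord0 j)) ->
  measurable_fun setT (V : T -> borelV R d).
Proof.
move=> mV; apply: (@measurability _ _ _ (borelV R d) _ _ (@open 'rV[R]_d)) => //.
move=> _ [A oA <-]; rewrite setTI.
pose c (i : 'rV[rat]_d * nat) : 'rV[R]_d := \row_j ratr (i.1 ord0 j).
pose r (i : 'rV[rat]_d * nat) : R := i.2.+1%:R^-1.
(* Balls that leave [A] contribute the empty set, so the union runs over all indices. *)
pose U (i : 'rV[rat]_d * nat) : set T :=
  if `[< ball (c i) (r i) `<=` A >] then V @^-1` ball (c i) (r i) else set0.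
have -> : V @^-1` A = \bigcup_i U i.
  apply/seteqP; split => [w /= Aw|w [i _]]; last first.
    by rewrite /U; case: asboolP => // sA; exact: sA.
  have /nbhs_ballP[e /= e0 be] : nbhs (V w) A by exact: open_nbhs_nbhs.
  (* A ball of radius below [e / 2] that contains [V w] lies in the ball of radius [e] around [V w],
     hence in [A]. *)
  have [n ne] : exists n : nat, n.+1%:R^-1 < e / 2.
    have e20 : 0 < e / 2 by rewrite divr_gt0.
    have [n _ /(_ n (leqnn n)) /= ne] := near_infty_natSinv_lt (PosNum e20).
    by exists n.
  have qP j : {q : rat | `|ratr q - V w ord0 j| < n.+1%:R^-1}.
    apply: cid.
    have /rat_in_itvoo[q] : V w ord0 j < V w ord0 j + n.+1%:R^-1 by rewrite ltrDl invr_gt0.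
    rewrite in_itv/= => /andP[q1 q2]; exists q.
    by rewrite gtr0_norm ?subr_gt0// ltrBlDl.
  pose i : 'rV[rat]_d * nat := (\row_j sval (qP j), n).
  have bi : ball (c i) (r i) (V w).
    split; first by rewrite /r invr_gt0.
    by move=> k j; rewrite (ord1 k) /ball/= !mxE /=; exact: (svalP (qP j)).
  exists i => //; rewrite /U; case: asboolP => // -[].
  move=> y yb; apply: be.
  have -> : e = e / 2 + e / 2 by rewrite -splitr.
  apply: (@ball_triangle _ _ (c i)).
    by apply: ball_sym; apply: le_ball bi; exact: ltW.
  by apply: le_ball yb; exact: ltW.
(* Rational centres and radii are coded by natural numbers to obtain a countable union. *)
have -> : \bigcup_i U i = \bigcup_n (if unpickle n is Some i then U i else set0).
  apply/seteqP; split => [w [i _ Ui]|w [n _]].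
    by exists (pickle i) => //; rewrite pickleK.
  by case: unpickle => // i Ui; exists i.
apply: bigcupT_measurable => n; case: unpickle => [i|]; last exact: measurable0.
rewrite /U; case: ifP => // _.
have -> : V @^-1` ball (c i) (r i) =
    \bigcap_(j in [set: 'I_d]) [set w | `|c i ord0 j - V w ord0 j| < r i].
  apply/seteqP; split => [w [_ bw] j _|w bw]; first exact: (bw ord0 j).
  by split=> [|k j]; rewrite ?(ord1 k) /r ?invr_gt0//; exact: (bw j).
apply: fin_bigcap_measurable => // j _.
rewrite -[X in measurable X]setTI.
apply: (measurable_fun_ltr _ (measurable_cst _)) => //.
apply: measurableT_comp => //; apply: measurable_funB => //.
Qed.

Lemma measurable_dot d' (T : measurableType d') (V W : T -> 'rV[R]_d) :
  (forall j, measurable_fun setT (fun w => V w ord0 j)) ->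
  (forall j, measurable_fun setT (fun w => W w ord0 j)) ->
  measurable_fun setT (fun w => dot (V w) (W w)).
Proof.
by move=> mV mW; apply: measurable_sum => j; exact: measurable_funM.
Qed.

End measurable_vectors.

(** * Integrability and real-valued expectations *)

Section expectation.
Context {d0 : measure_display} {T : measurableType d0} {R : realType}.
Variable P : probability T R.
Implicit Types (f g Z : T -> R).

Definition L1 f := P.-integrable setT (EFin \o f).
(** Real-valued, so that recursions are closed by linear arithmetic. Being the finite part of an
    integral it is meaningless without integrability, hence the [L1] conditions of the linear
    rules. *)
Definition Ex f : R := \int[P]_w f w.

Lemma L1_measurable f : L1 f -> measurable_fun setT f.
Proof. by move=> /measurable_int/measurable_EFinP. Qed.

Lemma L1D f g : L1 f -> L1 g -> L1 (fun w => f w + g w).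
Proof. by move=> f1 g1; exact: (integrableD measurableT f1 g1). Qed.

Lemma L1Z c f : L1 f -> L1 (fun w => c * f w).
Proof. by move=> f1; exact: (integrableZl measurableT c f1). Qed.

Lemma L1N f : L1 f -> L1 (fun w => - f w).
Proof. by move=> f1; exact: (integrableN f1). Qed.

Lemma L1_cst c : L1 (fun=> c).
Proof. exact: finite_measure_integrable_cst. Qed.

Lemma L1_sum (I : finType) (F : I -> T -> R) :
  (forall i, L1 (F i)) -> L1 (fun w => \sum_i F i w).
Proof.
move=> F1; have := @integrable_sum _ _ _ P setT measurableT I (index_enum I) predT (fun i => EFin \o F i) (fun i _ => F1 i).
by apply: eq_integrable => // w _ /=; rewrite sumEFin.
Qed.

Lemma L1_le f g : measurable_fun setT f -> (forall w, `|f w| <= g w) ->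
  L1 g -> L1 f.
Proof.
move=> mf fg g1; apply: (le_integrable _ _ _ g1) => //; first exact/measurable_EFinP.
by move=> w _ /=; rewrite lee_fin (le_trans (fg w))// ler_norm.
Qed.

Lemma L1_norm f : L1 f -> L1 (fun w => `|f w|).
Proof. exact: integrable_norm. Qed.

Lemma ExD f g : L1 f -> L1 g -> Ex (fun w => f w + g w) = Ex f + Ex g.
Proof. by move=> ? ?; exact: RintegralD. Qed.

Lemma ExB f g : L1 f -> L1 g -> Ex (fun w => f w - g w) = Ex f - Ex g.
Proof. by move=> ? ?; exact: RintegralB. Qed.

Lemma ExZ c f : L1 f -> Ex (fun w => c * f w) = c * Ex f.
Proof. by move=> ?; exact: RintegralZl. Qed.

Lemma Ex_cst c : Ex (fun=> c) = c.
Proof.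
rewrite /Ex Rintegral_cst// (_ : _ setT = 1%E) ?mulr1//.
exact: (@probability_setT _ _ _ P).
Qed.

Lemma Ex_le f g : L1 f -> L1 g -> (forall w, f w <= g w) -> Ex f <= Ex g.
Proof. by move=> ? ? fg; apply: le_Rintegral. Qed.

Lemma Ex_ge0 f : (forall w, 0 <= f w) -> 0 <= Ex f.
Proof. by move=> f0; apply: Rintegral_ge0. Qed.

Lemma eq_Ex f g : f =1 g -> Ex f = Ex g.
Proof. by move=> /funext ->. Qed.

Lemma Ex_sum (I : finType) (F : I -> T -> R) : (forall i, L1 (F i)) ->
  Ex (fun w => \sum_i F i w) = \sum_i Ex (F i).
Proof.
move=> F1; rewrite -big_enum; under eq_Ex do rewrite -big_enum.
elim: (enum I) => [|i s IH]; first by under eq_Ex do rewrite big_nil; rewrite Ex_cst big_nil.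
under eq_Ex do rewrite big_cons.
rewrite ExD// ?IH ?big_cons//.
elim: s {IH} => [|j s IH]; first by under eq_fun do rewrite big_nil; exact: L1_cst.
by under eq_fun do rewrite big_cons; exact: L1D.
Qed.

Lemma integral_Ex f : L1 f -> (\int[P]_w (f w)%:E)%E = (Ex f)%:E.
Proof. by move=> f1; rewrite fineK//; exact: integrable_fin_num. Qed.

End expectation.

(** * Integrating out an independent variable *)

Section independence.
Context {d0 : measure_display} {T : measurableType d0} {R : realType}.
Variable P : probability T R.

(** The joint law of [X] and [Y] agrees with a product measure on rectangles, hence everywhere;
    Tonelli's theorem then integrates [Y] out. Nonnegative extended values are used because
    integrability is sometimes what has to be proved. *)
Lemma integral_indep d1 (T1 : measurableType d1) d2 (T2 : measurableType d2)
    (X : T -> T1) (Y : T -> T2) (nu : probability T2 R)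
    (F : T1 * T2 -> \bar R) :
  measurable_fun setT X -> measurable_fun setT Y ->
  (forall A B, measurable A -> measurable B ->
    P (X @^-1` A `&` Y @^-1` B) = P (X @^-1` A) * nu B)%E ->
  measurable_fun setT F -> (forall z, 0 <= F z)%E ->
  (\int[P]_w F (X w, Y w) = \int[P]_w \int[nu]_y F (X w, y))%E.
Proof.
move=> mX mY XY mF F0.
pose X' : {mfun T >-> T1} := HB.pack X (isMeasurableFun.Build _ _ _ _ _ mX).
have mXY : measurable_fun setT (fun w => (X w, Y w)) by exact: measurable_fun_pair.
pose XY' : {mfun T >-> (T1 * T2)%type} :=
  HB.pack (fun w => (X w, Y w)) (isMeasurableFun.Build _ _ _ _ _ mXY).
have -> : (\int[P]_w F (X w, Y w) = \int[distribution P XY']_z F z)%E.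
  by rewrite ge0_integral_distribution.
have -> : (\int[distribution P XY']_z F z = \int[distribution P X' \x nu]_z F z)%E.
  apply: eq_measure_integral => A mA _.
  by apply/esym; apply: product_measure_unique => // B C mB mC; exact: XY.
rewrite fubini_tonelli1// ge0_integral_distribution//.
  exact: measurable_fun_fubini_tonelli_F.
by move=> x; apply: integral_ge0.
Qed.

Variable G : set (set T).
Hypothesis Gm : G `<=` measurable.

Lemma sub_gm : <<s G >> `<=` (@measurable _ T).
Proof. by apply: smallest_sub => //; exact: sigma_algebra_measurable. Qed.

Lemma measurable_fun_sub d1 (U : measurableType d1) (f : T -> U) :
  measurable_fun setT (f : g_sigma_algebraType G -> U) -> measurable_fun setT f.
Proof. by move=> mf _ B mB; apply: sub_gm; exact: (mf measurableT B mB). Qed.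

Section event.
Variable b : T -> bool.
Hypothesis mb : measurable_fun setT b.
Hypothesis indepb : forall A C, <<s G >> A ->
  P (A `&` b @^-1` C) = (P A * P (b @^-1` C))%E.

Let ge0_integral_indep (Z : T -> R) :
  measurable_fun setT (Z : g_sigma_algebraType G -> R) -> (forall w, 0 <= Z w) ->
  (\int[P]_w ((b w)%:R * Z w)%:E = P (b @^-1` [set true]) * \int[P]_w (Z w)%:E)%E.
Proof.
move=> mZ Z0.
pose Y : {mfun T >-> bool} := HB.pack b (isMeasurableFun.Build _ _ _ _ _ mb).
pose F (z : g_sigma_algebraType G * bool) : \bar R := (z.2%:R * Z z.1)%:E.
have mN : measurable_fun setT (fun b : bool => b%:R : R) by [].
have mF : measurable_fun setT F.
  apply/measurable_EFinP; apply: measurable_funM; last exact: (measurableT_comp mZ).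
  exact: (measurableT_comp mN measurable_snd).
have F0 z : (0 <= F z)%E by rewrite lee_fin mulr_ge0 ?ler0n.
(* The identity into the space with the coarser sigma-algebra plays the role of [X]: it is the past
   regarded as a single random variable. *)
have mid : measurable_fun setT (id : T -> g_sigma_algebraType G).
  by move=> _ A mA; rewrite setTI; exact: sub_gm.
have := @integral_indep _ (g_sigma_algebraType G) _ bool id b (distribution P Y) F mid mb _ mF F0.
move=> ->; last by move=> A C mA _; rewrite preimage_id; exact: indepb.
rewrite -ge0_integralZl//; last 2 first.
  by apply/measurable_EFinP; exact: (measurable_fun_sub mZ).
  by move=> w _; rewrite lee_fin.
apply: eq_integral => w _.
rewrite ge0_integral_distribution//.
rewrite /F /=; under eq_integral do rewrite EFinM.
rewrite ge0_integralZr//; last 2 first.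
- by apply/measurable_EFinP; exact: (measurableT_comp mN mb).
- by rewrite lee_fin.
congr (_ * _)%E.
have mB : measurable (b @^-1` [set true]) by rewrite -[X in measurable X]setTI; exact: mb.
rewrite -[RHS]mul1e -[RHS](integral_cst P mB).
rewrite [RHS]integral_mkcond; apply: eq_integral => x _.
rewrite patchE; case: ifPn; rewrite ?inE ?notin_setE/=; first by move=> ->.
by case: (b x).
Qed.

Lemma Ex_indep (Z : T -> R) :
  measurable_fun setT (Z : g_sigma_algebraType G -> R) -> L1 P Z ->
  L1 P (fun w => (b w)%:R * Z w) /\
  Ex P (fun w => (b w)%:R * Z w) = fine (P (b @^-1` [set true])) * Ex P Z.
Proof.
move=> mZ Z1.
have mN : measurable_fun setT (fun w => (b w)%:R : R).
  have mN : measurable_fun setT (fun b : bool => b%:R : R) by [].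
  exact: (measurableT_comp mN mb).
have l1 (V : T -> R) : L1 P V -> L1 P (fun w => (b w)%:R * V w).
  move=> V1; apply: (L1_le _ _ (L1_norm V1)).
    by apply: measurable_funM => //; exact: L1_measurable V1.
  by move=> w; rewrite normrM; case: (b w); rewrite ?normr1 ?mul1r ?normr0 ?mul0r.
split; first exact: l1.
have ge0 (V : T -> R) : measurable_fun setT (V : g_sigma_algebraType G -> R) ->
    L1 P V -> (forall w, 0 <= V w) ->
    Ex P (fun w => (b w)%:R * V w) = fine (P (b @^-1` [set true])) * Ex P V.
  move=> mV V1 V0; rewrite /Ex /Rintegral ge0_integral_indep// fineM//.
    apply: fin_num_measure; rewrite -[X in measurable X]setTI; exact: mb.
  exact: integrable_fin_num.
(* A signed [Z] is the difference of the nonnegative functions [V] and [|Z|], both measurable for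
   the past. *)
pose V w := `|Z w| + Z w.
have mn : measurable_fun setT ((fun w => `|Z w|) : g_sigma_algebraType G -> R).
  exact: measurableT_comp.
have V1 : L1 P V by apply: L1D => //; exact: L1_norm.
have EV : Ex P V = Ex P (fun w => `|Z w|) + Ex P Z by rewrite ExD//; exact: L1_norm.
have -> : Ex P (fun w => (b w)%:R * Z w) =
    Ex P (fun w => (b w)%:R * V w) - Ex P (fun w => (b w)%:R * `|Z w|).
  rewrite -ExB; [|exact: l1|exact/l1/L1_norm].
  by apply: eq_Ex => w; rewrite /V; ring.
rewrite !ge0 ?EV//; first ring.
- exact: L1_norm.
- exact: measurable_funD.
- by move=> w; rewrite /V; have := ler_norm (- Z w); rewrite normrN; lra.
Qed.

End event.
End independence.

(** * Independence of a fresh source from a list of sources *)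

Section mutual_independence.
Context {d0 : measure_display} {T : measurableType d0} {R : realType}.
Variables (P : probability T R) (I : choiceType) (G : I -> set (set T)).
Hypothesis Gmeas : forall i, G i `<=` measurable.
Hypothesis GT : forall i, G i setT.
Hypothesis GI : forall i, setI_closed (G i).
Hypothesis indepG : mutually_independent P G.

Definition gen (l : seq I) : set (set T) := \bigcup_(i in [set` l]) G i.

Lemma gen_measurable l : gen l `<=` measurable.
Proof. by move=> A [i _]; exact: Gmeas. Qed.

Lemma gen_sub l l' : {subset l <= l'} -> <<s gen l >> `<=` <<s gen l' >>.
Proof.
move=> ll'; apply: sub_sigma_algebra2 => A [i /= il GA].
by exists i => //=; exact: ll'.
Qed.

(** Pi-lambda argument: finite intersections of events, one per source of [l], form a pi-system
    generating the past, and on them the product formula is mutual independence of [s :: l]. *)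
Lemma indep_fresh s l : s \notin l ->
  forall A B, <<s gen l >> A -> G s B -> P (A `&` B) = (P A * P B)%E.
Proof.
move=> sl A B gA GB; have mB := Gmeas GB.
(* Mutual independence speaks of duplicate-free lists only. *)
pose l' := undup l.
pose pi := [set \bigcap_(i in [set` l']) C i | C in
              [set C : I -> set T | forall i, i \in l' -> G i (C i)]].
have mpi : pi `<=` measurable.
  move=> _ [C GC <-]; apply: fin_bigcap_measurable; first exact: finite_seq.
  by move=> i /= il; apply: (Gmeas (i := i)); exact: GC.
have gpi : <<s gen l >> `<=` <<s pi >>.
  apply: sub_sigma_algebra2 => C [i /= il GC].
  exists (fun j => if j == i then C else setT).
    by move=> j _; case: eqP => [->|_].
  apply/seteqP; split => [w /(_ i)/=|w Cw j _]; last by case: eqP.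
  by rewrite eqxx; apply; rewrite mem_undup.
have PB : P B = (fine (P B))%:E by rewrite fineK// fin_num_measure.
have PB0 : 0 <= fine (P B) by rewrite fine_ge0.
(* As functions of [A], the two sides are finite measures, to be compared on the pi-system. *)
suff PAB : mrestr P mB A = mscale (NngNum PB0) P A.
  by rewrite muleC PB; exact: PAB.
apply: (g_sigma_algebra_measure_unique pi mpi (fun _ : nat => setT)).
- move=> _; exists (fun=> setT) => //.
  by apply/seteqP; split.
- by rewrite bigcup_const//; exists 0%N.
- move=> _ _ [C GC <-] [D GD <-]; exists (fun i => C i `&` D i).
    by move=> i il; apply: GI; [exact: GC|exact: GD].
  by rewrite bigcapI.
- move=> _ [C GC <-]; suff : P (\bigcap_(i in [set` l']) C i `&` B) = (P B * P (\bigcap_(i in [set` l']) C i))%E.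
    by move=> PCB; apply: (etrans PCB); rewrite [in LHS]PB.
  (* [B] becomes the component at [s], so that the intersection with [B] is again one event per
     source. *)
  pose E i := if i == s then B else C i.
  have sl' : s \notin l' by rewrite mem_undup.
  have El' i : i \in l' -> E i = C i.
    by rewrite /E; case: eqP => // -> si; rewrite si in sl'.
  have capE : \bigcap_(i in [set` l']) C i = \bigcap_(i in [set` l']) E i.
    by apply: eq_bigcapr => i /= /El' ->.
  have Es : E s = B by rewrite /E eqxx.
  have GE i : i \in s :: l' -> G i (E i).
    by rewrite in_cons /E; case: eqP => [-> //|_ /= /GC].
  have -> : \bigcap_(i in [set` l']) C i `&` B = \bigcap_(i in [set` s :: l']) E i.
    rewrite capE; apply/seteqP; split => [w [Ew Bw] i /=|w Ew].
      by rewrite in_cons => /orP[/eqP ->|/Ew//]; rewrite Es.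
    split=> [i /= il|]; first by apply: (Ew i); rewrite /= in_cons il orbT.
    by rewrite -Es; apply: (Ew s); rewrite /= mem_head.
  rewrite capE indepG//; last by rewrite cons_uniq sl' undup_uniq.
  rewrite indepG ?undup_uniq//; last by move=> i il; apply: GE; rewrite in_cons il orbT.
  by rewrite big_cons Es.
- move=> _; suff: (P (setT `&` B) < +oo)%E by [].
  by rewrite setTI PB ltry.
- exact: gpi.
Qed.

End mutual_independence.

(** * Square-integrable vectors known from given draws *)

Lemma continuous_enorm_dist {R : realType} {d : nat} (x : 'rV[R]_d) :
  enorm (x - y) @[y --> x] --> (0 : R).
Proof.
have -> : (0 : R) = Num.sqrt (\sum_(j < d) (x ord0 j - x ord0 j) ^+ 2).
  by rewrite big1 ?sqrtr0// => j _; rewrite subrr expr0n.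
apply: (@cvg_comp _ _ _ _ (@Num.sqrt R)); last exact: sqrt_continuous.
have -> : (fun y => \sum_(j < d) (x - y) ord0 j ^+ 2) =
    (fun y => \sum_(j < d) (x ord0 j - y ord0 j) * (x ord0 j - y ord0 j)).
  by apply/funext => y; apply: eq_bigr => j _; rewrite !mxE expr2.
have H : Filter (nbhs x) by exact: nbhs_filter.
have := @cvg_big R 'I_d +%R 0 xpredT (@add_continuous R) _ (nbhs x) (index_enum 'I_d)
   (fun j y => (x ord0 j - y ord0 j) * (x ord0 j - y ord0 j)) (fun j => (x ord0 j - x ord0 j) ^+ 2) H.
apply=> j _; rewrite expr2.
by apply: cvgM; apply: cvgB; try exact: cvg_cst; exact: coord_continuous.
Qed.

(** Needed for the measurability of gradients at random points. The Lipschitz bound is Euclidean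
    while the topology is that of the sup norm, whence the detour through
    [continuous_enorm_dist]. *)
Lemma continuous_grad {R : realType} {d : nat} L (f : 'rV[R]_d -> R) j :
  smooth L f -> continuous (fun x => grad f x ord0 j).
Proof.
move=> [df lf] x; have Fx : Filter (nbhs x) by exact: nbhs_filter.
apply/cvgrPdist_lt => e e0.
have c0 : L * enorm (x - y) @[y --> x] --> (0 : R).
  by rewrite -(mulr0 L); apply: cvgM; [exact: cvg_cst|exact: continuous_enorm_dist].
move/cvgrPdist_lt : c0 => /(_ e e0); apply: (@filterS _ (nbhs x) Fx) => y.
rewrite sub0r normrN => ye; apply: le_lt_trans ye.
apply: le_trans (ler_norm _); apply: le_trans (lf x y).
rewrite -sqrtr_sqr /enorm ler_wsqrtr// (bigD1 j)//= !mxE lerDl.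
by apply: sumr_ge0 => i _; exact: sqr_ge0.
Qed.

Section square_integrable.
Context {d0 : measure_display} {T : measurableType d0} {R : realType}.
Variables (P : probability T R) (I : choiceType) (G : I -> set (set T)).
Hypothesis Gmeas : forall i, G i `<=` measurable.
Hypothesis GT : forall i, G i setT.
Hypothesis GI : forall i, setI_closed (G i).
Hypothesis indepG : mutually_independent P G.

Definition known {d1} {U : measurableType d1} (l : seq I) (Z : T -> U) : Prop :=
  measurable_fun setT (Z : g_sigma_algebraType (gen G l) -> U).

Lemma known_measurable {d1} {U : measurableType d1} l (Z : T -> U) :
  known l Z -> measurable_fun setT Z.
Proof. by apply: measurable_fun_sub; exact: gen_measurable. Qed.

Lemma known_sub {d1} {U : measurableType d1} l l' (Z : T -> U) :
  {subset l <= l'} -> known l Z -> known l' Z.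
Proof.
by move=> ll' kZ _ B mB; apply: (gen_sub ll'); exact: (kZ measurableT B mB).
Qed.

Lemma known_gen {d1} {U : measurableType d1} s l (Z : T -> U) :
  (forall B, measurable B -> G s (Z @^-1` B)) -> s \in l -> known l Z.
Proof.
move=> GZ sl _ B mB; rewrite setTI; apply: sub_sigma_algebra.
by exists s => //; exact: GZ.
Qed.

Context {d : nat}.
Implicit Types (V W : T -> 'rV[R]_d) (l : seq I).

(** Square integrability, rather than integrability, because it is stable under the vector
    operations and makes the inner product of any two such vectors integrable. *)
Definition sq l V : Prop :=
  (forall j, known l (fun w => V w ord0 j)) /\ L1 P (fun w => dot (V w) (V w)).

Lemma sq_sub l l' V : {subset l <= l'} -> sq l V -> sq l' V.
Proof. by move=> ll' [kV V1]; split => // j; exact: (known_sub ll'). Qed.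

Lemma sq_known l V : sq l V -> known l (V : T -> borelV R d).
Proof. by move=> [kV _]; exact: measurable_rV. Qed.

Lemma sq_known_dot l V W : sq l V -> sq l W -> known l (fun w => dot (V w) (W w)).
Proof. by move=> [kV _] [kW _]; exact: measurable_dot. Qed.

Lemma sq_measurable l V j : sq l V -> measurable_fun setT (fun w => V w ord0 j).
Proof. by move=> [kV _]; exact: (known_measurable (kV j)). Qed.

Lemma L1_dot l l' V W : sq l V -> sq l' W -> L1 P (fun w => dot (V w) (W w)).
Proof.
move=> sV sW; apply: (L1_le _ _ (L1D (proj2 sV) (proj2 sW))).
  by apply: measurable_dot => j; [exact: (sq_measurable j sV)|exact: (sq_measurable j sW)].
move=> w; rewrite ler_norml.
have := dot_young (V w) (W w) ltr01; have := dot_young (V w) (- W w) ltr01.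
have := dot_ge0 (V w); have := dot_ge0 (W w).
by rewrite invr1 !dotE; lra.
Qed.

Lemma sqD l V W : sq l V -> sq l W -> sq l (fun w => V w + W w).
Proof.
move=> sV sW; split=> [j|].
  have -> : (fun w => (V w + W w) ord0 j) = (fun w => V w ord0 j) \+ (fun w => W w ord0 j).
    by apply/funext => w; rewrite mxE.
  by apply: measurable_funD; [exact: (proj1 sV)|exact: (proj1 sW)].
have -> : (fun w => dot (V w + W w) (V w + W w)) =
   (fun w => dot (V w) (V w) + dot (V w) (W w) + (dot (W w) (V w) + dot (W w) (W w))).
  by apply/funext => w; rewrite !dotE; ring.
by apply: L1D; apply: L1D; [exact: (L1_dot sV sV)|exact: (L1_dot sV sW)|
  exact: (L1_dot sW sV)|exact: (L1_dot sW sW)].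
Qed.

Lemma sqZ l c V : sq l V -> sq l (fun w => c *: V w).
Proof.
move=> [kV V1]; split=> [j|].
  have -> : (fun w => (c *: V w) ord0 j) = (fun w => c * V w ord0 j).
    by apply/funext => w; rewrite mxE.
  by apply: measurable_funM => //; exact: kV.
have -> : (fun w => dot (c *: V w) (c *: V w)) = (fun w => c ^+ 2 * dot (V w) (V w)).
  by apply/funext => w; rewrite !dotE; ring.
exact: L1Z.
Qed.

Lemma sqB l V W : sq l V -> sq l W -> sq l (fun w => V w - W w).
Proof.
move=> sV sW; have := sqD sV (sqZ (-1) sW).
by under eq_fun do rewrite scaleN1r.
Qed.

Lemma sq_cst l v : sq l (fun=> v).
Proof. by split=> [j|]; [exact: measurable_cst|exact: L1_cst]. Qed.

Lemma sq_sum l (J : finType) (F : J -> T -> 'rV[R]_d) :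
  (forall i, sq l (F i)) -> sq l (fun w => \sum_i F i w).
Proof.
move=> sF; under eq_fun do rewrite -big_enum.
elim: (enum J) => [|i s IH]; first by under eq_fun do rewrite big_nil; exact: sq_cst.
by under eq_fun do rewrite big_cons; exact: sqD.
Qed.

Lemma sq_avg l n (F : 'I_n -> T -> 'rV[R]_d) :
  (forall i, sq l (F i)) -> sq l (fun w => avg (F ^~ w)).
Proof. by move=> sF; apply: sqZ; exact: sq_sum. Qed.

Lemma sq_le l V (g : T -> R) : (forall j, known l (fun w => V w ord0 j)) ->
  (forall w, dot (V w) (V w) <= g w) -> L1 P g -> sq l V.
Proof.
move=> kV Vg g1; split=> //; apply: (L1_le _ _ g1).
  by apply: measurable_dot => j; exact: (known_measurable (kV j)).
by move=> w; rewrite ger0_norm ?dot_ge0.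
Qed.

(** A Lipschitz gradient grows at most linearly, so its square is dominated by that of [V] plus a
    constant. *)
Lemma sq_grad l L (f : 'rV[R]_d -> R) V : 0 < L -> smooth L f -> sq l V ->
  sq l (fun w => grad f (V w)).
Proof.
move=> L0 sf sV.
apply: (@sq_le _ _ (fun w => 2 * L ^+ 2 * dot (V w) (V w) + 2 * dot (grad f 0) (grad f 0))).
- move=> j; exact: (measurableT_comp (measurable_continuous (continuous_grad (j := j) sf)) (sq_known sV)).
- move=> w; have := dot_add_le (grad f (V w) - grad f 0) (grad f 0).
  rewrite subrK => /le_trans; apply; rewrite lerD2r -mulrA ler_pM2l//.
  have LV : 0 <= L * enorm (V w) by rewrite mulr_ge0 ?enorm_ge0// ltW.
  rewrite -!enorm_sqr -exprMn ler_pXn2r ?nnegrE ?enorm_ge0//.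
  by have := proj2 sf (V w) 0; rewrite subr0.
- by apply: L1D; [apply: L1Z; exact: (proj2 sV)|exact: L1_cst].
Qed.

(** The gap lies between [0] and [L / 2] times the squared distance to the minimizer, where the
    gradient vanishes. *)
Lemma L1_gap l L (f : 'rV[R]_d -> R) xs V : 0 < L -> smooth L f ->
  (forall x, f xs <= f x) -> sq l V -> L1 P (fun w => f (V w) - f xs).
Proof.
move=> L0 sf mf sV; apply: (@L1_le _ _ _ _ _ (fun w => L / 2 * dot (V w - xs) (V w - xs))).
- apply: measurable_funB => //.
  apply: (measurableT_comp (f := f : borelV R d -> R)).
    apply: measurable_continuous => x; exact/differentiable_continuous/(proj1 sf).
  exact: (known_measurable (sq_known sV)).
- move=> w; rewrite ger0_norm ?subr_ge0//.
  by have := smooth_le sf xs (V w); rewrite (grad_min L0 sf mf) dot0l; lra.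
- by apply: L1Z; apply: (proj2 (sqB sV (sq_cst l xs))).
Qed.

(** * Vectors selected by an independent finite draw *)

Section select.
Variables (J : finType) (s : I) (ix : T -> J).
Hypothesis Gix : forall A : set J, G s (ix @^-1` A).

Lemma ix_measurable (b : pred J) : measurable_fun setT (b \o ix).
Proof.
move=> _ B _; rewrite setTI; apply: Gmeas.
exact: (Gix [set i | B (b i)]).
Qed.

(** The selected vector is a finite sum of indicators times the candidates, and its square is at
    most the sum of all their squares. *)
Lemma sq_select l (F : J -> T -> 'rV[R]_d) : (forall i, sq l (F i)) ->
  sq (s :: l) (fun w => F (ix w) w).
Proof.
move=> sF; apply: (@sq_le _ _ (fun w => \sum_i dot (F i w) (F i w))).
- move=> j; have -> : (fun w => F (ix w) w ord0 j) =
      (fun w => \sum_i (ix w == i)%:R * F i w ord0 j).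
    apply/funext => w; rewrite (bigD1 (ix w))//= eqxx mul1r big1 ?addr0// => i.
    by rewrite eq_sym => /negbTE ->; rewrite mul0r.
  apply: measurable_sum => i; apply: measurable_funM.
    have mN : measurable_fun setT (fun b : bool => b%:R : R) by [].
    apply: (measurableT_comp mN) => _ B _; rewrite setTI; apply: sub_sigma_algebra.
    by exists s; [rewrite /= mem_head|exact: (Gix [set i' | B (i' == i)])].
  have /(_ j) := proj1 (sF i); apply: known_sub => x xl.
  by rewrite in_cons xl orbT.
- move=> w; rewrite (bigD1 (ix w))//= lerDl.
  by apply: sumr_ge0 => i _; exact: dot_ge0.
- by apply: L1_sum => i; exact: (proj2 (sF i)).
Qed.

(** Total expectation over a fresh draw, one indicator at a time; it serves for index draws and,
    with two candidates, for the coin. *)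
Lemma Ex_select l (F : J -> T -> R) : s \notin l ->
  (forall i, known l (F i)) -> (forall i, L1 P (F i)) ->
  L1 P (fun w => F (ix w) w) /\
  Ex P (fun w => F (ix w) w) = \sum_i fine (P (ix @^-1` [set i])) * Ex P (F i).
Proof.
move=> sl kF F1.
have E : (fun w => F (ix w) w) = (fun w => \sum_i (ix w == i)%:R * F i w).
  apply/funext => w; rewrite (bigD1 (ix w))//= eqxx mul1r big1 ?addr0// => i.
  by rewrite eq_sym => /negbTE ->; rewrite mul0r.
have H i : L1 P (fun w => (ix w == i)%:R * F i w) /\
    Ex P (fun w => (ix w == i)%:R * F i w) = fine (P (ix @^-1` [set i])) * Ex P (F i).
  have -> : ix @^-1` [set i] = (fun w => ix w == i) @^-1` [set true].
    by apply/seteqP; split => w /= /eqP.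
  apply: (Ex_indep (gen_measurable Gmeas (l := l))) => //.
  - exact: (ix_measurable (fun j => j == i)).
  - move=> A C gA; apply: (indep_fresh Gmeas GT GI indepG sl) => //.
    exact: (Gix [set j | C (j == i)]).
  - exact: kF.
have S1 : L1 P (fun w => \sum_i (ix w == i)%:R * F i w).
  by apply: L1_sum => i; have [] := H i.
split; first by apply: (eq_ind_r (L1 P) S1 E).
rewrite (congr1 (Ex P) E) Ex_sum; last by move=> i; have [] := H i.
by apply: eq_bigr => i _; have [] := H i.
Qed.

End select.

Section uniform.
Context {m : nat} (s : I) (ix : T -> 'I_m).
Hypothesis m_gt0 : (0 < m)%N.
Hypothesis Gix : forall A : set 'I_m, G s (ix @^-1` A).
Hypothesis ix_law : forall i, P (ix @^-1` [set i]) = (m%:R^-1)%:E.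
Variables (l : seq I) (D : 'I_m -> T -> 'rV[R]_d).
Hypothesis sl : s \notin l.
Hypothesis sD : forall i, sq l (D i).

Definition noise w : 'rV[R]_d := D (ix w) w - avg (D ^~ w).

Lemma sq_noise : sq (s :: l) noise.
Proof.
apply: sqB; first exact: (sq_select Gix sD).
by apply: (@sq_sub l) => [x xl|]; [rewrite in_cons xl orbT|exact: sq_avg].
Qed.

(** For a frozen past, the deviations from the mean sum to zero over the equally likely indices. *)
Lemma Ex_dot_noise V : sq l V -> Ex P (fun w => dot (V w) (noise w)) = 0.
Proof.
move=> sV; have sA := sq_avg sD.
have sDA i : sq l (fun w => D i w - avg (D ^~ w)) by exact: sqB.
have [_ ->] := Ex_select Gix (F := fun i w => dot (V w) (D i w - avg (D ^~ w))) sl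
  (fun i => sq_known_dot sV (sDA i)) (fun i => L1_dot sV (sDA i)).
under eq_bigr do rewrite ix_law/=.
rewrite -mulr_sumr -Ex_sum; last by move=> i; exact: (L1_dot sV (sDA i)).
rewrite (@eq_Ex _ _ _ _ _ (fun=> 0)) ?Ex_cst ?mulr0// => w.
rewrite -dot_sumr sumrB sumr_const card_ord -scaler_nat scalerA divff ?scale1r ?subrr ?dot0r//.
by rewrite pnatr_eq0 -lt0n.
Qed.

Lemma Ex_noise_le : Ex P (fun w => dot (noise w) (noise w))
  <= m%:R^-1 * \sum_i Ex P (fun w => dot (D i w) (D i w)).
Proof.
have sA := sq_avg sD.
have sDA i : sq l (fun w => D i w - avg (D ^~ w)) by exact: sqB.
have [_ ->] := Ex_select Gix
  (F := fun i w => dot (D i w - avg (D ^~ w)) (D i w - avg (D ^~ w))) sl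
  (fun i => sq_known_dot (sDA i) (sDA i)) (fun i => L1_dot (sDA i) (sDA i)).
under eq_bigr do rewrite ix_law/=.
rewrite -mulr_sumr -!Ex_sum; last 2 first.
- by move=> i; exact: (L1_dot (sDA i) (sDA i)).
- by move=> i; exact: (proj2 (sD i)).
rewrite -!ExZ; last 2 first.
- by apply: L1_sum => i; exact: (proj2 (sD i)).
- by apply: L1_sum => i; exact: (proj2 (sDA i)).
apply: Ex_le.
- by apply: L1Z; apply: L1_sum => i; exact: (proj2 (sDA i)).
- by apply: L1Z; apply: L1_sum => i; exact: (proj2 (sD i)).
- by move=> w; rewrite avg_variance// gerBl dot_ge0.
Qed.

End uniform.

(** * Compression with an independent seed *)

Section compress.
Context {dS : measure_display} {S : measurableType dS}.
Variables (nu : probability S R) (delta : R) (Q : S -> 'rV[R]_d -> 'rV[R]_d).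
Hypothesis cQ : contraction_compressor delta nu Q.
Variables (s : I) (sd : T -> S).
Hypothesis Gsd : forall A, measurable A -> G s (sd @^-1` A).
Hypothesis sd_law : forall A, measurable A -> P (sd @^-1` A) = nu A.

(** The contraction bound holds for every frozen input; integrating the seed first applies it at the
    random point [V w]. The error [V - Q V] is the object treated since it is what the compressor
    controls. *)
Lemma sq_compress l V : s \notin l -> sq l V ->
  sq (s :: l) (fun w => V w - Q (sd w) (V w)) /\
  Ex P (fun w => dot (V w - Q (sd w) (V w)) (V w - Q (sd w) (V w)))
    <= (1 - delta) * Ex P (fun w => dot (V w) (V w)).
Proof.
move=> sl sV; have [/andP[de0 de1] mQ EQ] := cQ.
have ksd : known (s :: l) sd by apply: (known_gen Gsd); rewrite mem_head.
have sV' : sq (s :: l) V by apply: sq_sub sV => x xl; rewrite in_cons xl orbT.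
have kQ j : known (s :: l) (fun w => (V w - Q (sd w) (V w)) ord0 j).
  have -> : (fun w => (V w - Q (sd w) (V w)) ord0 j) =
      (fun w => V w ord0 j) \- (fun w => Q (sd w) (V w) ord0 j).
    by apply/funext => w; rewrite !mxE.
  apply: measurable_funB; first exact: (proj1 sV').
  have mp : known (s :: l) (fun w => (sd w, V w) : S * borelV R d).
    by apply: measurable_fun_pair => //; exact: (sq_known sV').
  exact: (measurableT_comp (measurable_coord j) (measurableT_comp mQ mp)).
pose Tl := g_sigma_algebraType (gen G l).
pose D (z : Tl * S) : 'rV[R]_d := V z.1 - Q z.2 (V z.1).
have mD : measurable_fun setT (fun z => dot (D z) (D z)).
  have mV : measurable_fun setT (fun z : Tl * S => V z.1 : borelV R d).
    exact: (measurableT_comp (sq_known sV) measurable_fst).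
  have mp : measurable_fun setT (fun z : Tl * S => (z.2, V z.1) : S * borelV R d).
    by apply: measurable_fun_pair => //; exact: measurable_snd.
  suff mDj j : measurable_fun setT (fun z => D z ord0 j) by exact: measurable_dot.
  have -> : (fun z => D z ord0 j) = (fun z => V z.1 ord0 j) \- (fun z => Q z.2 (V z.1) ord0 j).
    by apply/funext => z; rewrite /D !mxE.
  apply: measurable_funB; first exact: (measurableT_comp (measurable_coord j) mV).
  exact: (measurableT_comp (measurable_coord j) (measurableT_comp mQ mp)).
have mDw : measurable_fun setT (fun w => dot (D (w, sd w)) (D (w, sd w))).
  by apply: measurable_dot => j; exact: (known_measurable (kQ j)).
have mid : measurable_fun setT (id : T -> Tl).
  by move=> _ A mA; rewrite setTI; exact: (sub_gm (gen_measurable Gmeas (l := l))).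
have msd := known_measurable ksd.
(* Stated in the extended reals, because this bound is also the only source of integrability for the
   compression error. *)
have le : (\int[P]_w (dot (D (w, sd w)) (D (w, sd w)))%:E
    <= ((1 - delta) * Ex P (fun w => dot (V w) (V w)))%:E)%E.
  rewrite -ExZ; last exact: (proj2 sV).
  rewrite -integral_Ex; last by apply: L1Z; exact: (proj2 sV).
  have := @integral_indep _ _ _ P _ Tl _ S id sd nu (fun z => (dot (D z) (D z))%:E) mid msd.
  move=> ->; last 3 first.
  - move=> A B gA mB; rewrite preimage_id (indep_fresh Gmeas GT GI indepG sl)//; last exact: Gsd.
    by rewrite sd_law.
  - exact/measurable_EFinP.
  - by move=> z; rewrite lee_fin dot_ge0.
  apply: ge0_le_integral => //.
  - by move=> w _; apply: integral_ge0 => y _; rewrite lee_fin dot_ge0.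
  - apply: (@measurable_fun_sub _ _ _ (gen_measurable Gmeas (l := l))).
    apply: (@measurable_fun_fubini_tonelli_F _ _ Tl S R nu (fun z : Tl * S => (dot (D z) (D z))%:E)) => //.
      exact/measurable_EFinP.
    by move=> z; rewrite lee_fin dot_ge0.
  - apply/measurable_EFinP; apply: measurable_funM => //.
    exact: L1_measurable (proj2 sV).
  - move=> w _; rewrite -enorm_sqr; have := EQ (V w); rewrite unlock.
    by under eq_integral do rewrite enorm_sqr.
have D1 : L1 P (fun w => dot (D (w, sd w)) (D (w, sd w))).
  apply/integrableP; split; first exact/measurable_EFinP.
  under eq_integral do rewrite /= ger0_norm ?dot_ge0//.
  exact: (le_lt_trans le (ltry _)).
split; first by split.
by rewrite -lee_fin -integral_Ex.
Qed.

End compress.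
End square_integrable.

(** * The optimization problem *)

Lemma smooth_continuous {R : realType} {d : nat} L (f : 'rV[R]_d -> R) :
  smooth L f -> continuous f.
Proof. by move=> [df _] x; exact: differentiable_continuous. Qed.

Section problem.
Context {R : realType} (pb : problem R).

Definition node := node_obj (@fi R pb).
Definition obj := objective (@fi R pb).
Definition gap x := obj x - obj (xstar pb).

Lemma gap_ge0 x : 0 <= gap x.
Proof. by rewrite subr_ge0; exact: xstar_min. Qed.

Lemma grad_node t x : grad (node t) x = avg (fun i => grad (fi t i) x).
Proof. by apply: grad_scale_sum => i; exact: (proj1 (fi_smooth t i)). Qed.

Lemma grad_obj x : grad obj x = avg (fun t => grad (node t) x).
Proof. by apply: grad_scale_sum => t; exact: (proj1 (node_smooth t)). Qed.

Lemma grad_obj_xstar : grad obj (xstar pb) = 0.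
Proof. exact: (grad_min (L_obj_gt0 pb) (obj_smooth pb) (xstar_min (p := pb))). Qed.

Lemma item_convex t i x y :
  fi t i x + dot (grad (@fi R pb t i) x) (y - x) <= fi t i y.
Proof.
exact: (convex_grad (proj1 (fi_smooth t i)) (fi_convex t i)).
Qed.

Lemma node_convex t x y : node t x + dot (grad (node t) x) (y - x) <= node t y.
Proof.
rewrite grad_node dotZl dot_suml -mulrDr -big_split/= ler_wpM2l ?invr_ge0 ?ler0n//.
by apply: ler_sum => i _; exact: item_convex.
Qed.

Lemma obj_strong x y :
  obj x + dot (grad obj x) (y - x) + mu pb / 2 * dot (y - x) (y - x) <= obj y.
Proof.
exact: (strongly_convex_grad (proj1 (obj_smooth pb)) (@obj_strongly_convex _ pb)).
Qed.

Lemma obj_convex x y : obj x + dot (grad obj x) (y - x) <= obj y.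
Proof.
apply: le_trans (obj_strong x y); rewrite lerDl mulr_ge0 ?dot_ge0//.
by rewrite divr_ge0 ?mu_ge0.
Qed.

(* In dimension 0 the modulus [mu] may exceed [L_obj], so only this scaled form holds. *)
Lemma mu_le_L_obj (v : 'rV[R]_(dimension pb)) : mu pb * dot v v <= L_obj pb * dot v v.
Proof.
have := obj_strong 0 v; have := smooth_le (obj_smooth pb) 0 v.
by rewrite subr0 -/obj; lra.
Qed.

Lemma grad_obj_le x : dot (grad obj x) (grad obj x) <= 2 * L_obj pb * gap x.
Proof.
have := smooth_convex_grad (L_obj_gt0 pb) (obj_smooth pb) obj_convex x (xstar pb).
by rewrite -/obj grad_obj_xstar !subr0 dot0l subr0.
Qed.

Lemma node_grad_dist x y :
  (nodes pb)%:R^-1 * \sum_t dot (grad (node t) x - grad (node t) y) (grad (node t) x - grad (node t) y)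
    <= 4 * L_node pb * (gap x + gap y).
Proof.
apply: (@sum_grad_dist_le _ _ _ _ _ node obj).
- exact: L_node_gt0.
- by rewrite invr_ge0 ler0n.
- exact: node_smooth.
- exact: node_convex.
- by [].
- by rewrite -[LHS]grad_obj grad_obj_xstar.
Qed.

Lemma item_grad_dist x y :
  (nodes pb)%:R^-1 * \sum_t ((items pb)%:R^-1 *
     \sum_i dot (grad (fi t i) x - grad (fi t i) y) (grad (fi t i) x - grad (@fi R pb t i) y))
    <= 4 * L_item pb * (gap x + gap y).
Proof.
rewrite -mulr_sumr mulrA pair_big/=.
apply: (@sum_grad_dist_le _ _ _ _ _ (fun j => fi j.1 j.2) obj).
- exact: L_item_gt0.
- by rewrite mulr_ge0 ?invr_ge0 ?ler0n.
- by move=> j; exact: fi_smooth.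
- by move=> j; exact: item_convex.
- move=> z; rewrite /obj /objective /node_obj -mulr_sumr mulrA.
  by rewrite pair_big.
- rewrite -(pair_big xpredT xpredT (fun t i => grad (fi t i) (xstar pb)))/=.
  rewrite -[RHS]grad_obj_xstar grad_obj /avg -scalerA; congr (_ *: _).
  by rewrite scaler_sumr; apply: eq_bigr => t _; rewrite grad_node.
Qed.

(** Strong convexity gives [- 2 * eta * gap x], of which the inner product of [e] with the gradient
    takes back [eta / 2]. The 5 is 4 from that Young inequality plus 1 from moving the contraction
    from [x] to the virtual point. *)
Lemma exact_step_le eta x e : 0 < eta ->
  dot (x - e - xstar pb - eta *: grad obj x) (x - e - xstar pb - eta *: grad obj x)
  <= (1 - eta * mu pb / 2) * dot (x - e - xstar pb) (x - e - xstar pb)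
     - 3 / 2 * eta * gap x + 5 * eta * L_obj pb * dot e e
     + 2 * eta ^+ 2 * L_obj pb * gap x.
Proof.
move=> eta0; set g := grad obj x; set r := x - xstar pb.
have L0 := L_obj_gt0 pb.
have gL : dot g g <= 2 * L_obj pb * gap x := grad_obj_le x.
have cg : - dot r g <= - gap x - mu pb / 2 * dot r r.
  have := obj_strong x (xstar pb); rewrite -opprB -/r -/g dotNr dotNl dotNr opprK dotC /gap; lra.
(* The weight [4 * L_obj] makes the gradient term exactly [2^-1 * gap x] once [grad_obj_le] is
   applied. *)
have eg : 2 * dot e g <= 4 * L_obj pb * dot e e + 2^-1 * gap x.
  have L4 : 0 < 4 * L_obj pb by rewrite mulr_gt0.
  apply: (le_trans (dot_young e g L4)); rewrite lerD2l.
  by rewrite ler_pdivrMl//; lra.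
have -> : x - e - xstar pb = r - e by rewrite addrAC.
have re : dot (r - e) (r - e) <= 2 * dot r r + 2 * dot e e.
  by have := dot_add_le r (- e); rewrite dotNl dotNr opprK.
have mue := mu_le_L_obj e; have mu0 := mu_ge0 pb.
have expand (u v w : 'rV[R]_(dimension pb)) : dot (u - v - eta *: w) (u - v - eta *: w) =
    dot (u - v) (u - v) + eta * (2 * (- dot u w) + 2 * dot v w) + eta ^+ 2 * dot w w.
  by rewrite !dotE (dotC w u) (dotC w v); ring.
rewrite expand.
have h1 : eta * (2 * (- dot r g) + 2 * dot e g) <=
    eta * (2 * (- gap x - mu pb / 2 * dot r r) + (4 * L_obj pb * dot e e + 2^-1 * gap x)).
  by rewrite ler_pM2l//; lra.
have h2 : eta ^+ 2 * dot g g <= eta ^+ 2 * (2 * L_obj pb * gap x).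
  by rewrite ler_pM2l// exprn_gt0.
(* Half of the modulus is sacrificed to express the contraction through [r - e] instead of [r]; the
   excess in [e] is charged to [L_obj] by [mu_le_L_obj]. *)
have h3 : eta * (mu pb / 2 * dot (r - e) (r - e)) <= eta * (mu pb * dot r r + L_obj pb * dot e e).
  rewrite ler_pM2l//; have := ler_wpM2l mu0 re; lra.
lra.
Qed.

End problem.

(** * The iterates as random vectors *)

Section algorithm.
Context {R : realType} {pb : problem R} (a : ec_lsvrg pb).
Local Notation n := (nodes pb).
Local Notation m := (items pb).
Local Notation eta := (stepsize a).
Local Notation P := (Pr a).
Local Notation vec := 'rV[R]_(dimension pb).
Local Notation ix := (@idx _ _ a).
Local Notation sd := (@seed _ _ a).
Local Notation sd1 := (@seed1 _ _ a).
Local Notation cn := (@coin _ _ a).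

Definition events : source n -> set (set (Omega a)) :=
  source_events measurable measurable ix sd sd1 cn.

Lemma events_measurable s : events s `<=` measurable.
Proof.
case: s => [[[k t]|k]|k] A /=.
- move=> [B _ <-].
  have -> : ix k t @^-1` B = \bigcup_(i in B) (ix k t @^-1` [set i]).
    by apply/seteqP; split => [w Bw|w [i Bi /= ixi]]; [exists (ix k t w)|rewrite ixi].
  apply: fin_bigcup_measurable => // i _; exact: idx_meas.
- apply; split; first exact: sigma_algebra_measurable.
  move=> B [t _ [[C mC <-]|[C mC <-]]]; rewrite -[X in measurable X]setTI.
    exact: (seed_meas k t).
  exact: (seed1_meas k t).
- by move=> [B _ <-]; rewrite -[X in measurable X]setTI; exact: (coin_meas k).
Qed.

Lemma events_setT s : events s setT.
Proof.
case: s => [[[k t]|k]|k] /=; try by exists setT; rewrite ?preimage_setT.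
set E := \bigcup_(t in _) _.
exact: (@measurableT _ (g_sigma_algebraType E)).
Qed.

Lemma events_setI s : setI_closed (events s).
Proof.
case: s => [[[k t]|k]|k] A B /=.
- by move=> [C _ <-] [D _ <-]; exists (C `&` D).
- set E := \bigcup_(t in _) _.
  exact: (@measurableI _ (g_sigma_algebraType E)).
- by move=> [C _ <-] [D _ <-]; exists (C `&` D).
Qed.

Lemma events_indep : mutually_independent P events.
Proof. exact: sources_indep. Qed.

Lemma events_idx k t (A : set 'I_m) : events (inl (inl (k, t))) (ix k t @^-1` A).
Proof. by exists A. Qed.

Lemma events_coin k (A : set bool) : events (inr k) (cn k @^-1` A).
Proof. by exists A. Qed.

Lemma events_seed k t A : measurable A -> events (inl (inr k)) (sd k t @^-1` A).
Proof.
by move=> mA; apply: sub_sigma_algebra; exists t => //; left; exists A.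
Qed.

Lemma events_seed1 k t A : measurable A -> events (inl (inr k)) (sd1 k t @^-1` A).
Proof.
by move=> mA; apply: sub_sigma_algebra; exists t => //; right; exists A.
Qed.

Local Notation Em := events_measurable.
Local Notation ET := events_setT.
Local Notation EI := events_setI.
Local Notation Ein := events_indep.
Local Notation sqa := (@sq _ _ _ P _ events _).

(** Freshness is decided by time: all sources in [past k] carry an iteration number below [k]. *)
Definition source_time (s : source n) : nat :=
  match s with inl (inl (k, _)) => k | inl (inr k) => k | inr k => k end.

Definition draws k : seq (source n) :=
  [seq inl (inl (k, t)) | t <- enum 'I_n].

Fixpoint past k : seq (source n) :=
  if k is k'.+1 then inr k' :: inl (inr k') :: draws k' ++ past k' else [::].

Lemma past_time k s : s \in past k -> (source_time s < k)%N.
Proof.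
elim: k => //= k IH; rewrite !in_cons mem_cat => /or4P[/eqP ->|/eqP ->|/mapP[t _ ->]|/IH]//=.
exact: ltnW.
Qed.

Lemma draw_fresh k t : inl (inl (k, t)) \notin past k.
Proof. by apply/negP => /past_time; rewrite ltnn. Qed.

Lemma draw_fresh2 k t t' : t != t' ->
  inl (inl (k, t)) \notin inl (inl (k, t')) :: past k.
Proof.
move=> tt'; rewrite in_cons negb_or draw_fresh andbT.
by apply: contra tt' => /eqP[->].
Qed.

Lemma seed_fresh k : inl (inr k) \notin draws k ++ past k.
Proof.
rewrite mem_cat negb_or; apply/andP; split; first by apply/mapP => -[].
by apply/negP => /past_time; rewrite ltnn.
Qed.

Lemma coin_fresh k : inr k \notin inl (inr k) :: draws k ++ past k.
Proof.
rewrite in_cons mem_cat !negb_or; apply/and3P; split => //; first by apply/mapP => -[].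
by apply/negP => /past_time; rewrite ltnn.
Qed.

Definition pos k (w : Omega a) : vec := st_x (run k w).
Definition ref k (w : Omega a) : vec := st_w (run k w).
Definition err k t (w : Omega a) : vec := st_e (run k w) t.
Definition shift k t (w : Omega a) : vec := st_hloc (run k w) t.
Definition offset k t w : vec := grad (node t) (ref k w) - shift k t w.
Definition item_diff k t i w : vec :=
  grad (fi t i) (pos k w) - grad (fi t i) (ref k w).
Definition compressed k t w : vec :=
  eta *: (item_diff k t (ix k t w) w + grad (node t) (ref k w) - shift k t w)
  + err k t w.

Lemma runS k (w : Omega a) : run k.+1 w = step k w (run k w).
Proof. by []. Qed.

Lemma posS k w : pos k.+1 w = pos k w -
  (avg (fun t => Q (sd k t w) (compressed k t w)) + eta *: st_h (run k w)).
Proof.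
rewrite /pos runS /compressed /item_diff /pos /ref /shift /err.
by case: (run k w) => x v e hl h; reflexivity.
Qed.

Lemma refS k w : ref k.+1 w = if cn k w then pos k w else ref k w.
Proof. by rewrite /pos /ref runS; case: (run k w) => x v e hl h; reflexivity. Qed.

Lemma errS k t w : err k.+1 t w =
  compressed k t w - Q (sd k t w) (compressed k t w).
Proof.
rewrite /err runS /compressed /item_diff /pos /ref /shift /err.
case: (run k w) => x v e hl h; rewrite [X in _ = X - _]addrC; reflexivity.
Qed.

Lemma shiftS k t w : shift k.+1 t w =
  shift k t w + Q1 (sd1 k t w) (offset k t w).
Proof.
rewrite /shift runS /offset /ref /shift.
by case: (run k w) => x v e hl h; reflexivity.
Qed.

(** The server updates its shift incrementally, yet it remains the mean of the local shifts; hence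
    the shifts cancel in the virtual step. *)
Lemma st_h_avg k (w : Omega a) : st_h (run k w) = avg (shift k ^~ w).
Proof.
elim: k => [//|k IH].
have -> : st_h (run k.+1 w) =
    st_h (run k w) + avg (fun t => Q1 (sd1 k t w) (offset k t w)).
  rewrite runS /offset /ref /shift.
  by case: (run k w) => x v e hl h; reflexivity.
by rewrite IH avgD; congr avg; apply/funext => t; rewrite shiftS.
Qed.

(** The field [st_h] is covered by the local shifts through [st_h_avg]. *)
Definition sq_state k := [/\ sqa (past k) (pos k), sqa (past k) (ref k),
  forall t, sqa (past k) (err k t) & forall t, sqa (past k) (shift k t)].

Section step.
Variable k : nat.
Hypothesis sS : sq_state k.

Lemma sq_grad_node t V l : sqa l V -> sqa l (fun w => grad (@node _ pb t) (V w)).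
Proof. by apply: (sq_grad Em (L_node_gt0 pb)); exact: node_smooth. Qed.

Lemma sq_offset t : sqa (past k) (offset k t).
Proof.
have [_ sW _ sH] := sS; apply: (sqB Em) => //; exact: sq_grad_node.
Qed.

Lemma sq_item_diff t i : sqa (past k) (item_diff k t i).
Proof.
have [sX sW _ _] := sS.
by apply: (sqB Em); apply: (sq_grad Em (L_item_gt0 pb)) => //; exact: fi_smooth.
Qed.

Lemma draw_past_sub t :
  {subset inl (inl (k, t)) :: past k <= draws k ++ past k}.
Proof.
move=> s; rewrite in_cons mem_cat => /orP[/eqP ->|->]; last by rewrite orbT.
by apply/orP; left; apply/mapP; exists t => //; rewrite mem_enum.
Qed.

Lemma past_sub : {subset past k <= draws k ++ past k}.
Proof. by move=> s; rewrite mem_cat => ->; rewrite orbT. Qed.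

Lemma sq_compressed t : sqa (draws k ++ past k) (compressed k t).
Proof.
have [sX sW sE sH] := sS.
apply: (sqD Em); last by apply: sq_sub (sE t); exact: past_sub.
apply: (sqZ eta); apply: (sqB Em); last by apply: sq_sub (sH t); exact: past_sub.
apply: (sqD Em); last by apply: sq_sub (sq_grad_node t sW); exact: past_sub.
apply: sq_sub (sq_select Em (@events_idx k t) (sq_item_diff t)).
exact: draw_past_sub.
Qed.

Lemma err_step t : sqa (inl (inr k) :: draws k ++ past k) (err k.+1 t) /\
  Ex P (fun w => dot (err k.+1 t w) (err k.+1 t w))
    <= (1 - delta a) * Ex P (fun w => dot (compressed k t w) (compressed k t w)).
Proof.
have -> : err k.+1 t = (fun w => compressed k t w - Q (sd k t w) (compressed k t w)).
  by apply/funext => w; rewrite errS.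
apply: (sq_compress Em ET EI Ein (Q_compressor a) (@events_seed k t)) => //.
- exact: seed_law.
- exact: seed_fresh.
- exact: sq_compressed.
Qed.

(** The offset after the shift update but before the coin: the gradient is still taken at the old
    reference point. *)
Definition residual t w : vec := offset k t w - Q1 (sd1 k t w) (offset k t w).

Lemma residualE t w : residual t w = grad (node t) (ref k w) - shift k.+1 t w.
Proof. by rewrite /residual {1}/offset shiftS opprD addrA. Qed.

Lemma residual_step t : sqa (inl (inr k) :: draws k ++ past k) (residual t) /\
  Ex P (fun w => dot (residual t w) (residual t w))
    <= (1 - delta1 a) * Ex P (fun w => dot (offset k t w) (offset k t w)).
Proof.
apply: (sq_compress Em ET EI Ein (Q1_compressor a) (@events_seed1 k t)).
- exact: seed1_law.
- exact: seed_fresh.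
- by apply: sq_sub (sq_offset t); exact: past_sub.
Qed.

Lemma past_sub2 : {subset past k <= inl (inr k) :: draws k ++ past k}.
Proof. by move=> s /past_sub; rewrite in_cons => ->; rewrite orbT. Qed.

Lemma sq_shiftS t : sqa (inl (inr k) :: draws k ++ past k) (shift k.+1 t).
Proof.
have [_ sW _ _] := sS.
(* The contraction controls the residual and not the output of [Q1], so the new shift is recovered
   from the residual. *)
have -> : shift k.+1 t = (fun w => grad (node t) (ref k w) - residual t w).
  by apply/funext => w; rewrite residualE subKr.
apply: (sqB Em); last exact: (proj1 (residual_step t)).
by apply: sq_grad_node; apply: sq_sub sW; exact: past_sub2.
Qed.

Lemma sq_stateS : sq_state k.+1.
Proof.
have [sX sW sE sH] := sS.
have sub : {subset inl (inr k) :: draws k ++ past k <= past k.+1}.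
  by move=> s /= h; rewrite in_cons h orbT.
have sub' : {subset past k <= past k.+1} by move=> s /past_sub2/sub.
split.
(* The messages are rewritten as compressed vector minus new error, both already known to be
   square-integrable. *)
- have -> : pos k.+1 = (fun w => pos k w - (avg (fun t => compressed k t w - err k.+1 t w)
      + eta *: avg (shift k ^~ w))).
    apply/funext => w; rewrite posS st_h_avg.
    rewrite (_ : (fun t => Q (sd k t w) _) = (fun t => compressed k t w - err k.+1 t w))//.
    by apply/funext => t; rewrite errS subKr.
  apply: (sqB Em); first by apply: sq_sub sX.
  apply: (sqD Em); last first.
    by apply: sqZ; apply: (sq_avg Em) => t; apply: sq_sub (sH t).
  apply: (sq_avg Em) => t; apply: (sqB Em).
    by apply: sq_sub (sq_compressed t) => s h; apply: sub; rewrite in_cons h orbT.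
  by apply: sq_sub (proj1 (err_step t)).
- have -> : ref k.+1 = (fun w => (if cn k w then pos k else ref k) w).
    by apply/funext => w; rewrite refS; case: ifP.
  apply: (@sq_sub _ _ _ _ _ _ _ (inr k :: past k)).
    by move=> s; rewrite in_cons => /orP[/eqP ->|/sub'//]; rewrite /= mem_head.
  apply: (sq_select Em (@events_coin k) (F := fun b => if b then pos k else ref k)).
  by case.
- by move=> t; apply: sq_sub (proj1 (err_step t)).
- by move=> t; apply: sq_sub (sq_shiftS t).
Qed.

End step.

Lemma sq_run k : sq_state k.
Proof.
elim: k => [|k IH]; last exact: sq_stateS.
by split; [exact: sq_cst|exact: sq_cst|move=> t; exact: sq_cst|move=> t; exact: sq_cst].
Qed.

End algorithm.

(** * One-step recursions *)

Ltac integrable_tac :=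
  repeat first [assumption | apply: L1D | apply: L1N | apply: L1Z].

Section recursion.
Context {R : realType} {pb : problem R} (a : ec_lsvrg pb).
Local Notation n := (nodes pb).
Local Notation m := (items pb).
Local Notation eta := (stepsize a).
Local Notation P := (Pr a).
Local Notation vec := 'rV[R]_(dimension pb).
Local Notation ix := (@idx _ _ a).
Local Notation past := (@past _ pb).
Local Notation draws := (@draws _ pb).
Local Notation pos := (@pos _ _ a).
Local Notation ref := (@ref _ _ a).
Local Notation err := (@err _ _ a).
Local Notation shift := (@shift _ _ a).
Local Notation offset := (@offset _ _ a).
Local Notation compressed := (@compressed _ _ a).
Local Notation Em := (@events_measurable _ _ a).
Local Notation ET := (@events_setT _ _ a).
Local Notation EI := (@events_setI _ _ a).
Local Notation Ein := (@events_indep _ _ a).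
Local Notation sqa := (@sq _ _ _ P _ (@events _ _ a) _).

Definition gap_pos k : R := Ex P (fun w => gap (pos k w)).
Definition gap_ref k : R := Ex P (fun w => gap (ref k w)).
Definition virtual k w : vec := pos k w - avg (err k ^~ w) - xstar pb.
Definition dist2 k : R := Ex P (fun w => dot (virtual k w) (virtual k w)).
Definition err2 k : R :=
  n%:R^-1 * \sum_t Ex P (fun w => dot (err k t w) (err k t w)).
Definition offset2 k : R :=
  n%:R^-1 * \sum_t Ex P (fun w => dot (offset k t w) (offset k t w)).

Lemma L1_gap_pos k : L1 P (fun w => gap (pos k w)).
Proof.
have [sX _ _ _] := sq_run a k.
exact: (L1_gap Em (L_obj_gt0 pb) (obj_smooth pb) (@xstar_min _ pb) sX).
Qed.

Lemma L1_gap_ref k : L1 P (fun w => gap (ref k w)).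
Proof.
have [_ sW _ _] := sq_run a k.
exact: (L1_gap Em (L_obj_gt0 pb) (obj_smooth pb) (@xstar_min _ pb) sW).
Qed.

Lemma gap_pos_ge0 k : 0 <= gap_pos k.
Proof. by apply: Ex_ge0 => w; exact: gap_ge0. Qed.

Lemma gap_ref_ge0 k : 0 <= gap_ref k.
Proof. by apply: Ex_ge0 => w; exact: gap_ge0. Qed.

Lemma dist2_ge0 k : 0 <= dist2 k.
Proof. by apply: Ex_ge0 => w; exact: dot_ge0. Qed.

Lemma err2_ge0 k : 0 <= err2 k.
Proof.
rewrite mulr_ge0 ?invr_ge0 ?ler0n// sumr_ge0// => t _.
by apply: Ex_ge0 => w; exact: dot_ge0.
Qed.

Lemma offset2_ge0 k : 0 <= offset2 k.
Proof.
rewrite mulr_ge0 ?invr_ge0 ?ler0n// sumr_ge0// => t _.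
by apply: Ex_ge0 => w; exact: dot_ge0.
Qed.

Lemma Ex_avg (F : 'I_n -> Omega a -> R) : (forall t, L1 P (F t)) ->
  L1 P (fun w => n%:R^-1 * \sum_t F t w) /\
  Ex P (fun w => n%:R^-1 * \sum_t F t w) = n%:R^-1 * \sum_t Ex P (F t).
Proof.
move=> F1; have S1 := L1_sum F1; split; first exact: L1Z.
by rewrite ExZ// Ex_sum.
Qed.

Section step.
Variable k : nat.

Definition xi t : Omega a -> vec := noise (ix k t) (item_diff (a := a) k t).

Let sX : sqa (past k) (pos k). Proof. by have [] := sq_run a k. Qed.
Let sW : sqa (past k) (ref k). Proof. by have [] := sq_run a k. Qed.
Let sE t : sqa (past k) (err k t). Proof. by have [] := sq_run a k. Qed.
Let sH t : sqa (past k) (shift k t). Proof. by have [] := sq_run a k. Qed.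
Let sD t i : sqa (past k) (item_diff k t i).
Proof. exact: (sq_item_diff (sq_run a k) t i). Qed.

Let sxi t : sqa (inl (inl (k, t)) :: past k) (xi t).
Proof. exact: (sq_noise Em (@events_idx _ _ a k t) (sD t)). Qed.

Let law t i : P (ix k t @^-1` [set i]) = (m%:R^-1)%:E.
Proof. exact: idx_law. Qed.

Let Ex_dot_xi t V : sqa (past k) V -> Ex P (fun w => dot (V w) (xi t w)) = 0.
Proof.
move=> sV; exact: (Ex_dot_noise Em ET EI Ein (items_gt0 pb) (@events_idx _ _ a k t)
  (law t) (draw_fresh k t) (sD t) sV).
Qed.

(** The noise of node [t] is known once its draw is added to the past, and the draw of [t'] is still
    fresh for this larger list. *)
Let Ex_cross t t' : t != t' -> Ex P (fun w => dot (xi t w) (xi t' w)) = 0.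
Proof.
move=> tt'.
have sD' i : sqa (inl (inl (k, t)) :: past k) (item_diff k t' i).
  by apply: sq_sub (sD t' i) => s sp; rewrite in_cons sp orbT.
apply: (Ex_dot_noise Em ET EI Ein (items_gt0 pb) (@events_idx _ _ a k t')
  (law t') _ sD' (sxi t)).
by apply: draw_fresh2; rewrite eq_sym.
Qed.

Lemma xi2_le : n%:R^-1 * \sum_t Ex P (fun w => dot (xi t w) (xi t w))
  <= 4 * L_item pb * (gap_pos k + gap_ref k).
Proof.
pose F t w : R := m%:R^-1 * \sum_i dot (item_diff (a := a) k t i w) (item_diff k t i w).
have F1 t : L1 P (F t).
  by apply: L1Z; apply: L1_sum => i; exact: (proj2 (sD t i)).
apply: (@le_trans _ _ (n%:R^-1 * \sum_t Ex P (F t))).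
  rewrite ler_wpM2l ?invr_ge0 ?ler0n// ler_sum// => t _.
  apply: le_trans (Ex_noise_le Em ET EI Ein (items_gt0 pb) (@events_idx _ _ a k t)
    (law t) (draw_fresh k t) (sD t)) _.
  have D1 i : L1 P (fun w => dot (item_diff (a := a) k t i w) (item_diff k t i w)).
    exact: (proj2 (sD t i)).
  by rewrite ExZ ?Ex_sum//; exact: L1_sum.
have [S1 <-] := Ex_avg F1.
have G1 : L1 P (fun w => gap (pos k w) + gap (ref k w)).
  by apply: L1D; [exact: L1_gap_pos|exact: L1_gap_ref].
rewrite -ExD; [|exact: L1_gap_pos|exact: L1_gap_ref].
rewrite -ExZ//; apply: Ex_le => //; first exact: L1Z.
by move=> w; exact: item_grad_dist.
Qed.

Let sxi' t : sqa (draws k ++ past k) (xi t).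
Proof. by apply: sq_sub (sxi t); exact: draw_past_sub. Qed.

(** The off-diagonal terms of the double sum vanish, which gains the factor [1 / n]. *)
Lemma avg_xi2_le : Ex P (fun w => dot (avg (xi ^~ w)) (avg (xi ^~ w)))
  <= 4 * L_item pb / n%:R * (gap_pos k + gap_ref k).
Proof.
have x1 t t' : L1 P (fun w => dot (xi t w) (xi t' w)) by exact: (L1_dot Em (sxi t) (sxi t')).
have -> : Ex P (fun w => dot (avg (xi ^~ w)) (avg (xi ^~ w))) =
    Ex P (fun w => n%:R^-1 * (n%:R^-1 * \sum_t \sum_t' dot (xi t w) (xi t' w))).
  apply: eq_Ex => w; rewrite dotZl dotZr dot_suml.
  by do 2 congr (_ * _); apply: eq_bigr => t _; rewrite dot_sumr.
have s1 t : L1 P (fun w => \sum_t' dot (xi t w) (xi t' w)) by exact: L1_sum.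
have [S1 SE] := Ex_avg s1; rewrite ExZ// SE.
have -> : \sum_t Ex P (fun w => \sum_t' dot (xi t w) (xi t' w)) =
    \sum_t Ex P (fun w => dot (xi t w) (xi t w)).
  apply: eq_bigr => t _; rewrite Ex_sum// (bigD1 t)//= big1 ?addr0// => t' tt'.
  by rewrite Ex_cross// eq_sym.
rewrite (mulrAC _ n%:R^-1) mulrC ler_wpM2r ?invr_ge0 ?ler0n//.
exact: xi2_le.
Qed.

Lemma avg_item_diff t w :
  avg (item_diff k t ^~ w) = grad (@node _ pb t) (pos k w) - grad (node t) (ref k w).
Proof. by rewrite !grad_node avgN avgD. Qed.

Lemma compressedE t w : compressed k t w =
  err k t w + eta *: (grad (node t) (pos k w) - shift k t w) + eta *: xi t w.
Proof.
rewrite /compressed /xi /noise avg_item_diff.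
move: (item_diff _ _ _ _) (grad _ (pos k w)) (grad _ _) (shift _ _ _) (err _ _ _).
move=> D g g' h e.
by apply/rowP => j; rewrite !mxE; ring.
Qed.

(** The compressed messages cancel: what leaves the position enters the errors with the opposite
    effect. The server shift cancels against the mean of the local shifts inside [compressed]. *)
Lemma virtualS w : virtual k.+1 w =
  virtual k w - eta *: grad (@obj _ pb) (pos k w) - eta *: avg (xi ^~ w).
Proof.
have e1 : avg (err k.+1 ^~ w) =
    avg (compressed k ^~ w) - avg (fun t => Q (seed k t w) (compressed k t w)).
  by rewrite avgN avgD; congr avg; apply/funext => t; rewrite errS.
have e2 : avg (compressed k ^~ w) = avg (err k ^~ w)
    + eta *: (grad (@obj _ pb) (pos k w) - avg (shift k ^~ w)) + eta *: avg (xi ^~ w).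
  rewrite grad_obj avgN !avgD !avgZ !avgD; congr avg; apply/funext => t.
  exact: compressedE.
rewrite /virtual posS st_h_avg e1 e2.
move: (grad _ _) => g.
move: (avg _) (avg _) (avg _) (avg _) (pos k w) (xstar pb) => q h e N x xs.
by apply/rowP => j; rewrite !mxE; ring.
Qed.

Lemma dist2_step : dist2 k.+1 <= (1 - eta * mu pb / 2) * dist2 k
  - 3 / 2 * eta * gap_pos k + 5 * eta * L_obj pb * err2 k
  + 2 * eta ^+ 2 * L_obj pb * gap_pos k
  + eta ^+ 2 * (4 * L_item pb / n%:R * (gap_pos k + gap_ref k)).
Proof.
pose A w : vec := virtual k w - eta *: grad (@obj _ pb) (pos k w).
pose N w : vec := avg (xi ^~ w).
have sx : sqa (past k) (fun=> xstar pb) by exact: sq_cst.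
have sV : sqa (past k) (virtual k) := sqB Em (sqB Em sX (sq_avg Em sE)) sx.
have sA : sqa (past k) A.
  apply: (sqB Em) => //; apply: sqZ.
  exact: (sq_grad Em (L_obj_gt0 pb) (obj_smooth pb)).
have sN : sqa (draws k ++ past k) N by exact: (sq_avg Em).
have N1 := proj2 sN; have A1 := proj2 sA; have AN1 := L1_dot Em sA sN.
have -> : dist2 k.+1 = Ex P (fun w => dot (A w) (A w) + (- (2 * eta) * dot (A w) (N w)
     + eta ^+ 2 * dot (N w) (N w))).
  apply: eq_Ex => w; rewrite virtualS -/(A w) -/(N w).
  move: (A w) (N w) => u v; rewrite !dotE (dotC v u); ring.
rewrite !ExD ?ExZ//; try by integrable_tac.
have -> : Ex P (fun w => dot (A w) (N w)) = 0.
  rewrite (@eq_Ex _ _ _ _ _ (fun w => n%:R^-1 * \sum_t dot (A w) (xi t w))); last first.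
    by move=> w; rewrite /N dotZr dot_sumr.
  have [_ ->] := Ex_avg (fun t => L1_dot Em sA (sxi t)).
  by rewrite big1 ?mulr0// => t _; exact: Ex_dot_xi.
rewrite mulr0 add0r; apply: lerD; last first.
  by rewrite ler_pM2l ?exprn_gt0 ?stepsize_gt0//; exact: avg_xi2_le.
have [e1 eE] := Ex_avg (fun t => proj2 (sE t)).
have v1 := proj2 sV; have g1 := L1_gap_pos k.
rewrite /err2 -eE /dist2 /gap_pos -!ExZ// -ExB -?ExD//; try by integrable_tac.
apply: Ex_le => //; first by integrable_tac.
move=> w; apply: le_trans (exact_step_le (pos k w) (avg (err k ^~ w)) (stepsize_gt0 a)) _.
rewrite lerD2r lerD2l ler_wpM2l//; last exact: (avg_dot_le _ (nodes_gt0 pb)).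
by rewrite !mulr_ge0// ltW ?stepsize_gt0 ?L_obj_gt0.
Qed.

(** The Young weight [de / (2 * (1 - de))] solves [(1 - de) * (1 + c) = 1 - de / 2]. It degenerates
    at [de = 1], where the left side is zero. *)
Lemma compressed_split (de : R) (u v : vec) : 0 < de <= 1 ->
  (1 - de) * dot (u + v) (u + v) <=
  (1 - de / 2) * dot u u + (1 - de) * (2 / de) * dot v v.
Proof.
move=> /andP[d0 d1]; have [->|dn] := eqVneq de 1.
  by rewrite subrr !mul0r addr0 mulr_ge0 ?dot_ge0//; lra.
have d1' : 0 < 1 - de by rewrite subr_gt0 lt_neqAle dn.
have c0 : 0 < de / (2 * (1 - de)) by rewrite divr_gt0// mulr_gt0.
have := dot_split u v c0; rewrite -(ler_pM2l d1') => /le_trans; apply.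
have -> : (1 - de) * ((1 + de / (2 * (1 - de))) * dot u u + (1 + (de / (2 * (1 - de)))^-1) * dot v v)
   = (1 - de / 2) * dot u u + (1 - de) * ((2 - de) / de) * dot v v.
  by field; rewrite !gt_eqF.
rewrite lerD2l ler_wpM2r ?dot_ge0// ler_pM2l// ler_pM2r ?invr_gt0//; lra.
Qed.

Lemma err2_step (de := delta a) : err2 k.+1 <= (1 - de / 2) * err2 k
  + (1 - de) * eta ^+ 2 *
    (2 / de * (8 * L_node pb * (gap_pos k + gap_ref k) + 2 * offset2 k)
     + 4 * L_item pb * (gap_pos k + gap_ref k)).
Proof.
have [/andP[d0 d1] _ _] := Q_compressor a; rewrite -/de in d0 d1.
have d1' : 0 <= 1 - de by rewrite subr_ge0.
have ninv : 0 <= n%:R^-1 :> R by rewrite invr_ge0 ler0n.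
have sG t : sqa (past k) (fun w => grad (node t) (pos k w)).
  exact: sq_grad_node.
have sGW t : sqa (past k) (fun w => grad (node t) (ref k w)).
  exact: sq_grad_node.
pose B t w : vec := grad (node t) (pos k w) - shift k t w.
have sB t : sqa (past k) (B t) by exact: (sqB Em).
pose U t w : vec := err k t w + eta *: B t w.
have sU t : sqa (past k) (U t) by apply: (sqD Em) => //; exact: sqZ.
(* Exact split by orthogonality, so that the noise escapes the factor [2 / de] paid by the rest. *)
have EC t : Ex P (fun w => dot (compressed k t w) (compressed k t w)) =
    Ex P (fun w => dot (U t w) (U t w)) + eta ^+ 2 * Ex P (fun w => dot (xi t w) (xi t w)).
  have U1 := proj2 (sU t); have x1 := proj2 (sxi t); have Ux1 := L1_dot Em (sU t) (sxi t).
  rewrite (@eq_Ex _ _ _ _ _ (fun w => dot (U t w) (U t w) + (2 * eta * dot (U t w) (xi t w)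
     + eta ^+ 2 * dot (xi t w) (xi t w)))); last first.
    move=> w; rewrite compressedE -/(B t w) -/(U t w); move: (U t w) (xi t w) => u v.
    by rewrite !dotE (dotC v u); ring.
  rewrite !ExD ?ExZ//; try by integrable_tac.
  by rewrite Ex_dot_xi// mulr0 add0r.
have EU t : (1 - de) * Ex P (fun w => dot (U t w) (U t w)) <=
    (1 - de / 2) * Ex P (fun w => dot (err k t w) (err k t w))
    + (1 - de) * (2 / de) * eta ^+ 2 * Ex P (fun w => dot (B t w) (B t w)).
  have U1 := proj2 (sU t); have e1 := proj2 (sE t); have B1 := proj2 (sB t).
  rewrite -!ExZ// -ExD; [|exact: L1Z|exact: L1Z].
  apply: Ex_le; [exact: L1Z|by apply: L1D; exact: L1Z|move=> w].
  apply: le_trans (compressed_split _ _ _) _; first by rewrite d0.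
  by rewrite lerD2l dotZl dotZr le_eqVlt; apply/orP; left; apply/eqP; ring.
have EB : n%:R^-1 * \sum_t Ex P (fun w => dot (B t w) (B t w)) <=
    8 * L_node pb * (gap_pos k + gap_ref k) + 2 * offset2 k.
  have off1 t := proj2 (sq_offset (sq_run a k) t).
  have [B1 <-] := Ex_avg (fun t => proj2 (sB t)).
  have [Of1 OE] := Ex_avg off1; rewrite /offset2 -OE.
  have g1 := L1_gap_pos k; have g2 := L1_gap_ref k.
  have g12 := L1D g1 g2.
  rewrite -(ExD g1 g2) -!ExZ// -ExD; [|exact: L1Z|exact: L1Z].
  apply: Ex_le => //; first by apply: L1D; exact: L1Z.
  move=> w; apply: (@le_trans _ _ (n%:R^-1 * \sum_t
     (2 * dot (grad (node t) (pos k w) - grad (node t) (ref k w))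
              (grad (node t) (pos k w) - grad (node t) (ref k w))
      + 2 * dot (offset k t w) (offset k t w)))).
    rewrite ler_wpM2l// ler_sum// => t _.
    have -> : B t w = (grad (node t) (pos k w) - grad (node t) (ref k w)) + offset k t w.
      by rewrite /B /offset addrA subrK.
    exact: dot_add_le.
  rewrite big_split/= -!mulr_sumr mulrDr; apply: lerD; last by rewrite mulrCA.
  rewrite mulrCA; have := node_grad_dist (pos k w) (ref k w); lra.
have x2 := xi2_le.
have le1 : err2 k.+1 <= n%:R^-1 * \sum_t ((1 - de / 2) * Ex P (fun w => dot (err k t w) (err k t w))
    + (1 - de) * (2 / de) * eta ^+ 2 * Ex P (fun w => dot (B t w) (B t w))
    + (1 - de) * eta ^+ 2 * Ex P (fun w => dot (xi t w) (xi t w))).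
  rewrite ler_wpM2l// ler_sum// => t _.
  have [_ /le_trans] := err_step (sq_run a k) t; apply.
  by rewrite EC mulrDr mulrA lerD2r; exact: EU.
apply: (le_trans le1) => {le1}.
rewrite !big_split/= -!mulr_sumr.
move: EB x2; rewrite /err2; set S1 := \sum_t _; set S2 := \sum_t _; set S3 := \sum_t _.
move=> hB hX.
have -> : n%:R^-1 * ((1 - de / 2) * S3 + (1 - de) * (2 / de) * eta ^+ 2 * S1 + (1 - de) * eta ^+ 2 * S2)
   = (1 - de / 2) * (n%:R^-1 * S3) + (1 - de) * eta ^+ 2 * (2 / de * (n%:R^-1 * S1) + n%:R^-1 * S2).
  by ring.
have c0 : 0 <= (1 - de) * eta ^+ 2 by rewrite mulr_ge0// exprn_ge0// ltW// stepsize_gt0.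
by rewrite lerD2l ler_wpM2l//; apply: lerD => //; rewrite ler_wpM2l// divr_ge0// ltW.
Qed.

Let coin_prob b : fine (P (@coin _ _ a k @^-1` [set b])) =
  if b then p_coin a else 1 - p_coin a.
Proof.
case: b; first by rewrite coin_law.
have -> : @coin _ _ a k @^-1` [set false] = ~` (@coin _ _ a k @^-1` [set true]).
  by apply/seteqP; split => w /=; case: (coin _ _).
rewrite probability_setC ?coin_law//.
by rewrite -[X in measurable X]setTI; exact: (coin_meas k).
Qed.

Lemma gap_ref_step :
  gap_ref k.+1 = p_coin a * gap_pos k + (1 - p_coin a) * gap_ref k.
Proof.
pose F (b : bool) w : R := if b then gap (pos k w) else gap (ref k w).
have F1 b : L1 P (F b) by case: b; [exact: L1_gap_pos|exact: L1_gap_ref].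
have kgap (V : Omega a -> vec) : sqa (past k) V -> known (@events _ _ a) (past k) (fun w => gap (V w)).
  move=> sV; have co : continuous (@obj _ pb) := smooth_continuous (obj_smooth pb).
  have mo := measurableT_comp (measurable_continuous co) (sq_known sV).
  exact: (measurable_funB mo (measurable_cst (obj (xstar pb)))).
have kF b : known (@events _ _ a) (past k) (F b) by case: b; exact: kgap.
have fr : inr k \notin past k.
  by apply: contra (coin_fresh k); exact: past_sub2.
have [_ EF] := Ex_select Em ET EI Ein (@events_coin _ _ a k) fr kF F1.
transitivity (Ex P (fun w => F (@coin _ _ a k w) w)).
  by apply: eq_Ex => w; rewrite refS /F; case: (coin _ _).
by rewrite EF big_bool !coin_prob.
Qed.

(** The weight [de / (2 * p)] makes the total coefficient of [dot u u] equal to [1 + de / 2], small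
    enough not to spoil the contraction of the shifts. *)
Lemma coin_split (p de : R) (u v : vec) : 0 < p -> 0 < de ->
  p * dot (u + v) (u + v) + (1 - p) * dot u u <=
  (1 + de / 2) * dot u u + p * (1 + 2 * p / de) * dot v v.
Proof.
move=> p0 d0; have c0 : 0 < de / (2 * p) by rewrite divr_gt0// mulr_gt0.
have := dot_split u v c0; rewrite -(ler_pM2l p0) => uv.
apply: (le_trans (lerD uv (lexx _))).
rewrite le_eqVlt; apply/orP; left; apply/eqP; field.
by rewrite !gt_eqF.
Qed.

Lemma offset2_step (p := p_coin a) (de := delta1 a) :
  offset2 k.+1 <= (1 - de / 2) * offset2 k
  + p * (1 + 2 * p / de) * (4 * L_node pb * (gap_pos k + gap_ref k)).
Proof.
have [/andP[d0 d1] _ _] := Q1_compressor a; rewrite -/de in d0 d1.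
have /andP[p0 p1] := p_coin_range a; rewrite -/p in p0 p1.
have ninv : 0 <= n%:R^-1 :> R by rewrite invr_ge0 ler0n.
pose r := residual (a := a) k.
pose D t w : vec := grad (@node _ pb t) (pos k w) - grad (node t) (ref k w).
have sD' t : sqa (past k) (D t) by apply: (sqB Em); exact: sq_grad_node.
have sr t := proj1 (residual_step (sq_run a k) t).
have sD2 t : sqa (inl (inr k) :: draws k ++ past k) (D t).
  by apply: sq_sub (sD' t); exact: past_sub2.
have srD t := sqD Em (sr t) (sD2 t).
have D1 t := proj2 (sD' t); have r1 t := proj2 (sr t); have rD1 t := proj2 (srD t).
have Et t : Ex P (fun w => dot (offset k.+1 t w) (offset k.+1 t w)) <=
    (1 - de / 2) * Ex P (fun w => dot (offset k t w) (offset k t w))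
    + p * (1 + 2 * p / de) * Ex P (fun w => dot (D t w) (D t w)).
  (* The two outcomes of the coin, which is fresh even after the compression of this iteration: if
     it moves the reference point, the gradient drift [D] is added to the residual. *)
  pose F (b : bool) w : R :=
    if b then dot (r t w + D t w) (r t w + D t w) else dot (r t w) (r t w).
  have F1 b : L1 P (F b) by case: b; [exact: rD1|exact: r1].
  have kF b : known (@events _ _ a) (inl (inr k) :: draws k ++ past k) (F b).
    by case: b; [exact: (sq_known_dot (srD t) (srD t))|exact: (sq_known_dot (sr t) (sr t))].
  have [_ EF] := Ex_select Em ET EI Ein (@events_coin _ _ a k) (coin_fresh k) kF F1.
  have -> : Ex P (fun w => dot (offset k.+1 t w) (offset k.+1 t w)) =
      Ex P (fun w => F (@coin _ _ a k w) w).
    apply: eq_Ex => w; rewrite /offset refS /F /r residualE /D.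
    case: (coin _ _) => //.
    rewrite -[in LHS](subrK (grad (node t) (ref k w)) (grad (node t) (pos k w))).
    by rewrite -addrA addrC.
  rewrite EF big_bool !coin_prob /= -/p.
  apply: (@le_trans _ _ ((1 + de / 2) * Ex P (fun w => dot (r t w) (r t w))
     + p * (1 + 2 * p / de) * Ex P (fun w => dot (D t w) (D t w)))).
    rewrite -!ExZ// -!ExD; try by integrable_tac.
    by apply: Ex_le; [by integrable_tac|by integrable_tac|move=> w; exact: coin_split].
  rewrite lerD2r.
  have [_ rle] := residual_step (sq_run a k) t; rewrite -/r -/de in rle.
  have := Ex_ge0 P (fun w => dot_ge0 (offset k t w)).
  move: rle; set y := Ex _ _; set z := Ex _ _ => rle z0.
  (* The loss from the coin and the gain from [Q1] combine to
     [(1 + de / 2) * (1 - de) <= 1 - de / 2]. *)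
  apply: (@le_trans _ _ ((1 + de / 2) * ((1 - de) * z))).
    by rewrite ler_pM2l//; lra.
  by rewrite mulrA ler_wpM2r//; nra.
have ED : n%:R^-1 * \sum_t Ex P (fun w => dot (D t w) (D t w)) <=
    4 * L_node pb * (gap_pos k + gap_ref k).
  have [DD1 <-] := Ex_avg D1.
  have g1 := L1_gap_pos k; have g2 := L1_gap_ref k; have g12 := L1D g1 g2.
  rewrite -(ExD g1 g2) -!ExZ//; apply: Ex_le => //; first exact: L1Z.
  by move=> w; exact: node_grad_dist.
apply: (@le_trans _ _ (n%:R^-1 * \sum_t
   ((1 - de / 2) * Ex P (fun w => dot (offset k t w) (offset k t w))
    + p * (1 + 2 * p / de) * Ex P (fun w => dot (D t w) (D t w))))).
  by rewrite ler_wpM2l// ler_sum.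
rewrite big_split/= -!mulr_sumr mulrDr; apply: lerD; first by rewrite mulrCA.
have q0 : 0 < 2 * p / de by rewrite divr_gt0// mulr_gt0.
have c0 : 0 < p * (1 + 2 * p / de) by rewrite mulr_gt0// addr_gt0.
by rewrite mulrCA ler_wpM2l// ltW.
Qed.

End step.
End recursion.

(** * The Lyapunov function *)

Section arithmetic.
Context {R : realType}.
Implicit Types x y z v c : R.

Lemma le_div_of c x y z : 0 < c -> 0 < z -> c * x * y <= z -> x * y / z <= 1 / c.
Proof.
by move=> c0 z0 h; rewrite ler_pdivrMr// mul1r ler_pdivlMl// mulrA.
Qed.

(** Since [320 / 3600 + 80 / 4096 + 1280 / 14400] is just below [1 / 5]. *)
Lemma gain_arith v x y z : x <= 1 / 3600 -> y <= 1 / 4096 -> z <= 1 / 14400 ->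
  4 * v + 320 * x + 80 * y + 1280 * z <= 4 * v + 1 / 5.
Proof. lra. Qed.

End arithmetic.

Section lyapunov.
Context {R : realType} {pb : problem R} (a : ec_lsvrg pb).
Local Notation eta := (stepsize a).
Local Notation p := (p_coin a).
Local Notation de := (delta a).
Local Notation d1 := (delta1 a).
Local Notation L := (L_item pb).
Local Notation Lb := (L_node pb).
Local Notation Lf := (L_obj pb).
Local Notation n := ((nodes pb)%:R : R).

(** The entries of [eta_max], squared where they contain roots and cleared of denominators, hence
    free of infinite values when [delta = 1]. *)
Definition small_stepsize : Prop :=
  [/\ eta * (4 * Lf + 33 * L / n) <= 1,
      3600 * ((1 - de) * Lf * Lb) * eta ^+ 2 <= de ^+ 2,
      4096 * ((1 - de) * Lf * L) * eta ^+ 2 <= de &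
      14400 * ((1 - de) * Lf * Lb * p * (1 + 2 * p / d1)) * eta ^+ 2
        <= de ^+ 2 * d1].

Lemma stepsize_le_div (q r : R) : 0 < q -> 0 <= r ->
  (eta%:E <= q%:E / r%:E)%E -> eta * r <= q.
Proof.
move=> q0 r0; have [->|rn] := eqVneq r 0; first by move=> _; rewrite mulr0 ltW.
have rp : 0 < r by rewrite lt_def rn.
by rewrite inver (negbTE rn) -EFinM lee_fin ler_pdivlMr.
Qed.

Let n_gt0 : 0 < n. Proof. by rewrite ltr0n; exact: nodes_gt0. Qed.
Let eta_gt0 : 0 < eta. Proof. exact: stepsize_gt0. Qed.
Let p_gt0 : 0 < p. Proof. by have /andP[] := p_coin_range a. Qed.
Let de_gt0 : 0 < de. Proof. by have [/andP[]] := Q_compressor a. Qed.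
Let de_le1 : de <= 1. Proof. by have [/andP[]] := Q_compressor a. Qed.
Let d1_gt0 : 0 < d1. Proof. by have [/andP[]] := Q1_compressor a. Qed.
Let L_gt0 : 0 < L. Proof. exact: L_item_gt0. Qed.
Let Lb_gt0 : 0 < Lb. Proof. exact: L_node_gt0. Qed.
Let Lf_gt0 : 0 < Lf. Proof. exact: L_obj_gt0. Qed.
Let mu_ge0' : 0 <= mu pb. Proof. exact: mu_ge0. Qed.

Let de_compl : 0 <= 1 - de. Proof. by rewrite subr_ge0. Qed.

Let sqr_bound (c q r : R) : 0 <= c -> 0 <= r -> 0 <= q ->
  eta * (c * Num.sqrt r) <= q -> c ^+ 2 * r * eta ^+ 2 <= q ^+ 2.
Proof.
move=> c0 r0 q0 h.
have -> : c ^+ 2 * r * eta ^+ 2 = (eta * (c * Num.sqrt r)) ^+ 2.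
  by rewrite !exprMn sqr_sqrtr//; ring.
by rewrite ler_pXn2r ?nnegrE ?mulr_ge0 ?sqrtr_ge0// ltW.
Qed.

Lemma eta_max_small : (eta%:E <= eta_max a)%E -> small_stepsize.
Proof.
have r1 : 0 <= (1 - de) * Lf * Lb by rewrite !mulr_ge0// ltW.
have r2 : 0 <= (1 - de) * Lf * L by rewrite !mulr_ge0// ltW.
have r3 : 0 <= (1 - de) * Lf * Lb * p * (1 + 2 * p / d1).
  by rewrite mulr_ge0// ?mulr_ge0// ?addr_ge0// ?divr_ge0// ?mulr_ge0// ltW.
rewrite /eta_max !le_min => /and4P[h1 h2 h3 h4]; split.
- apply: stepsize_le_div h1 => //; apply: ltW.
  by rewrite addr_gt0// ?divr_gt0// ?mulr_gt0.
- have -> : (3600 : R) = 60 ^+ 2 by ring.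
  apply: sqr_bound => //; first exact: ltW.
  by apply: stepsize_le_div h2; rewrite ?mulr_ge0 ?sqrtr_ge0.
- have -> : (4096 : R) = 64 ^+ 2 by ring.
  rewrite -[leRHS](sqr_sqrtr (ltW de_gt0)).
  apply: sqr_bound => //.
  by apply: stepsize_le_div h3; rewrite ?mulr_ge0 ?sqrtr_ge0 ?sqrtr_gt0.
- have -> : (14400 : R) = 120 ^+ 2 by ring.
  have -> : de ^+ 2 * d1 = (de * Num.sqrt d1) ^+ 2.
    by rewrite exprMn sqr_sqrtr// ltW.
  apply: sqr_bound => //; first by rewrite mulr_ge0 ?sqrtr_ge0// ltW.
  by apply: stepsize_le_div h4; rewrite ?mulr_gt0 ?mulr_ge0 ?sqrtr_ge0 ?sqrtr_gt0.
Qed.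

Lemma rho_bounds : [/\ rho a <= mu pb * eta / 2, rho a <= de / 4,
  rho a <= d1 / 4 & rho a <= p / 4].
Proof.
by have := lexx (rho a); rewrite {2}/rho !le_min => /and4P[].
Qed.

Lemma rho_ge0 : 0 <= rho a.
Proof. by rewrite /rho !le_min !divr_ge0// ?mulr_ge0// ltW. Qed.

Lemma rho_lt1 : rho a < 1.
Proof. by have [_ h _ _] := rho_bounds; have := de_le1; lra. Qed.

(* The coefficients are solved from the requirement that the errors, the shifts
   and the reference gap keep the contraction factors [1 - delta/4],
   [1 - delta1/4] and [1 - p/4] after absorbing what they feed into the other
   recursions. *)
Definition coef_err : R := 20 * eta * Lf / de.
Definition coef_offset : R := 16 * coef_err * (1 - de) * eta ^+ 2 / (de * d1).
(** Total coefficient with which the sum of the gaps at iterate and reference point is fed back: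
    through the averaged noise, the errors and the shifts. *)
Definition gap_gain : R := 4 * eta ^+ 2 * L / n
  + coef_err * (1 - de) * eta ^+ 2 * (16 * Lb / de + 4 * L)
  + 4 * coef_offset * (p * (1 + 2 * p / d1)) * Lb.
Definition coef_ref : R := 4 * gap_gain / (3 * p).

Definition lyapunov k : R := dist2 a k + coef_err * err2 a k
  + coef_offset * offset2 a k + coef_ref * gap_ref a k.

Lemma coef_err_ge0 : 0 <= coef_err.
Proof. by rewrite divr_ge0// ?mulr_ge0// ltW. Qed.

Lemma coef_offset_ge0 : 0 <= coef_offset.
Proof.
have c0 := coef_err_ge0; have e2 : 0 <= eta ^+ 2 by exact: sqr_ge0.
have d0 := ltW de_gt0; have d0' := ltW d1_gt0.
apply: divr_ge0; last exact: mulr_ge0.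
by apply: mulr_ge0 => //; apply: mulr_ge0 => //; apply: mulr_ge0.
Qed.

Let pq_ge0 : 0 <= p * (1 + 2 * p / d1).
Proof. by rewrite mulr_ge0// ?addr_ge0// ?divr_ge0// ?mulr_ge0// ltW. Qed.

Lemma gap_gain_ge0 : 0 <= gap_gain.
Proof.
have e2 : 0 <= eta ^+ 2 by exact: sqr_ge0.
have [d0 l0 lb0] := And3 (ltW de_gt0) (ltW L_gt0) (ltW Lb_gt0).
rewrite /gap_gain; apply: addr_ge0; first apply: addr_ge0.
- apply: divr_ge0; last exact: ltW.
  by apply: mulr_ge0 => //; apply: mulr_ge0.
- apply: mulr_ge0; last by rewrite addr_ge0// !(divr_ge0, mulr_ge0).
  by apply: mulr_ge0 => //; apply: mulr_ge0 => //; exact: coef_err_ge0.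
- apply: mulr_ge0 => //; apply: mulr_ge0 => //; apply: mulr_ge0 => //.
  exact: coef_offset_ge0.
Qed.

Lemma coef_ref_ge0 : 0 <= coef_ref.
Proof. by rewrite divr_ge0 ?mulr_ge0 ?gap_gain_ge0// ltW. Qed.

Lemma lyapunov_ge0 k : 0 <= lyapunov k.
Proof.
have := mulr_ge0 coef_err_ge0 (err2_ge0 a k).
have := mulr_ge0 coef_offset_ge0 (offset2_ge0 a k).
have := mulr_ge0 coef_ref_ge0 (gap_ref_ge0 a k).
by have := dist2_ge0 a k; rewrite /lyapunov; lra.
Qed.

Hypothesis small : small_stepsize.

(** After expansion of the coefficients, the error and shift parts of [gap_gain] are multiples of
    the three quotients bounded by the last three stepsize conditions; the noise part is left for
    the first. *)
Lemma gap_gain_le : gap_gain <= eta * (4 * (eta * L / n) + 1 / 5).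
Proof.
have [hA hB hC hD] := small.
have -> : gap_gain = eta * (4 * (eta * L / n)
   + 320 * ((1 - de) * Lf * Lb * eta ^+ 2 / de ^+ 2)
   + 80 * ((1 - de) * Lf * L * eta ^+ 2 / de)
   + 1280 * ((1 - de) * Lf * Lb * p * (1 + 2 * p / d1) * eta ^+ 2 / (de ^+ 2 * d1))).
  rewrite /gap_gain /coef_offset /coef_err; field.
  by rewrite !gt_eqF.
have [c1 c2 c3] : [/\ 0 < 3600 :> R, 0 < 4096 :> R & 0 < 14400 :> R].
  by split; exact: ltr0Sn.
have z1 : 0 < de ^+ 2 by exact: exprn_gt0.
rewrite ler_pM2l//; exact: (gain_arith _ (le_div_of c1 z1 hB)
  (le_div_of c2 de_gt0 hC) (le_div_of c3 (mulr_gt0 z1 d1_gt0) hD)).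
Qed.

Let hA' : 4 * (eta * Lf) + 33 * (eta * L / n) <= 1.
Proof. by have [hA _ _ _] := small; apply: le_trans hA; rewrite le_eqVlt; apply/orP; left; apply/eqP; ring. Qed.

Let etaL_ge0 : 0 <= eta * L / n. Proof. by rewrite divr_ge0// ?mulr_ge0// ltW. Qed.

Lemma lyapunov_step k :
  lyapunov k.+1 <= (1 - rho a) * lyapunov k - eta / 2 * gap_pos a k.
Proof.
have hT := dist2_step a k; have hE := err2_step a k.
have hH := offset2_step a k; have hW := gap_ref_step a k.
have [rm rd rd1 rp] := rho_bounds.
have T0 := dist2_ge0 a k; have E0 := err2_ge0 a k; have H0 := offset2_ge0 a k.
have w0 := gap_ref_ge0 a k; have x0 := gap_pos_ge0 a k.
move: hT hE hH hW T0 E0 H0 w0 x0; rewrite /lyapunov.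
move: (dist2 a k.+1) (err2 a k.+1) (offset2 a k.+1) (gap_ref a k.+1).
move: (dist2 a k) (err2 a k) (offset2 a k) (gap_ref a k) (gap_pos a k).
move=> T E H w x T' E' H' w' hT hE hH -> T0 E0 H0 w0 x0.
have {}hE := ler_wpM2l coef_err_ge0 hE.
have {}hH := ler_wpM2l coef_offset_ge0 hH.
have cE : 5 * eta * Lf = coef_err * (de / 4).
  by rewrite /coef_err; field; rewrite gt_eqF.
have cH : coef_err * (1 - de) * eta ^+ 2 * (4 / de) = coef_offset * (d1 / 4).
  by rewrite /coef_offset; field; rewrite !gt_eqF.
have cW : gap_gain = coef_ref * (3 * p / 4).
  by rewrite /coef_ref; field; rewrite gt_eqF.
(* The [7 / 3] is 1 for the direct feedback plus [4 / 3] from [coef_ref * p], the price of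
   refreshing the reference point. *)
have gain : 2 * eta ^+ 2 * Lf * x + 7 / 3 * gap_gain * x <= eta * x.
  have -> : 2 * eta ^+ 2 * Lf * x = eta * (2 * (eta * Lf)) * x by ring.
  rewrite -mulrDl ler_wpM2r//; have := gap_gain_le; have := hA'; have := etaL_ge0.
  set u := eta * Lf; set v := eta * L / n => v0 uv gg.
  (* Half of the first stepsize condition bounds [2 * u + 33 / 2 * v] by [1 / 2]; the constant
     [7 / 15] fits in the other half. *)
  apply: (@le_trans _ _ (eta * (2 * u + 7 / 3 * (4 * v + 1 / 5)))); first lra.
  by rewrite ger_pMr//; lra.
have sum : T' + coef_err * E' + coef_offset * H' + coef_ref * (p * x + (1 - p) * w) <=
   (1 - eta * mu pb / 2) * T + (5 * eta * Lf + coef_err * (1 - de / 2)) * E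
   + (coef_err * (1 - de) * eta ^+ 2 * (4 / de) + coef_offset * (1 - d1 / 2)) * H
   + (gap_gain + coef_ref * (1 - p)) * w
   + (- (3 / 2 * eta) + 2 * eta ^+ 2 * Lf + gap_gain + coef_ref * p) * x.
  apply: (le_trans (lerD (lerD (lerD hT hE) hH) (lexx _))).
  by rewrite le_eqVlt; apply/orP; left; apply/eqP; rewrite /gap_gain; ring.
apply: (le_trans sum); rewrite cE cH.
have e1 : (1 - eta * mu pb / 2) * T <= (1 - rho a) * T.
  by rewrite ler_wpM2r//; lra.
have e2 : (coef_err * (de / 4) + coef_err * (1 - de / 2)) * E <= (1 - rho a) * (coef_err * E).
  rewrite [leRHS]mulrA ler_wpM2r// -mulrDr mulrC ler_wpM2r ?coef_err_ge0//; lra.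
have e3 : (coef_offset * (d1 / 4) + coef_offset * (1 - d1 / 2)) * H <= (1 - rho a) * (coef_offset * H).
  rewrite [leRHS]mulrA ler_wpM2r// -mulrDr mulrC ler_wpM2r ?coef_offset_ge0//; lra.
have e4 : (gap_gain + coef_ref * (1 - p)) * w <= (1 - rho a) * (coef_ref * w).
  rewrite [leRHS]mulrA ler_wpM2r// cW -mulrDr mulrC ler_wpM2r ?coef_ref_ge0//; lra.
have e5 : coef_ref * p = 4 / 3 * gap_gain.
  by rewrite /coef_ref; field; rewrite gt_eqF.
rewrite e5; lra.
Qed.

Lemma weight_gt0 k : 0 < weight a k.
Proof. by rewrite invr_gt0 exprn_gt0// subr_gt0 rho_lt1. Qed.

(** Multiplied by [weight a k], the one-step recursion telescopes, because
    [(1 - rho) * weight (k + 1) = weight k]. *)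
Lemma weighted_gap_sum k :
  eta / 2 * \sum_(i < k) weight a i * gap_pos a i
    + (1 - rho a) * (weight a k * lyapunov k) <= (1 - rho a) * lyapunov 0.
Proof.
have r1 : 0 < 1 - rho a by rewrite subr_gt0 rho_lt1.
elim: k => [|k IH]; first by rewrite big_ord0 mulr0 add0r /weight expr0 invr1 mul1r.
apply: le_trans IH; rewrite big_ord_recr/= mulrDr -addrA lerD2l.
have -> : (1 - rho a) * (weight a k.+1 * lyapunov k.+1) = weight a k * lyapunov k.+1.
  by rewrite /weight exprS; field; rewrite -/(weight a k) !gt_eqF// exprn_gt0.
have := lyapunov_step k; rewrite -(ler_pM2l (weight_gt0 k)); lra.
Qed.

End lyapunov.

(** * From the Lyapunov recursion to the two rates *)

Section rates.
Context {R : realType} {pb : problem R} (a : ec_lsvrg pb).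
Local Notation eta := (stepsize a).
Local Notation p := (p_coin a).
Local Notation de := (delta a).
Local Notation d1 := (delta1 a).
Local Notation L := (L_item pb).
Local Notation Lb := (L_node pb).
Local Notation Lf := (L_obj pb).
Local Notation n := ((nodes pb)%:R : R).
Local Notation P := (Pr a).

Let n_gt0 : 0 < n. Proof. by rewrite ltr0n; exact: nodes_gt0. Qed.
Let eta_gt0 : 0 < eta. Proof. exact: stepsize_gt0. Qed.
Let p_gt0 : 0 < p. Proof. by have /andP[] := p_coin_range a. Qed.
Let de_gt0 : 0 < de. Proof. by have [/andP[]] := Q_compressor a. Qed.
Let de_le1 : de <= 1. Proof. by have [/andP[]] := Q_compressor a. Qed.
Let d1_gt0 : 0 < d1. Proof. by have [/andP[]] := Q1_compressor a. Qed.
Let Lb_gt0 : 0 < Lb. Proof. exact: L_node_gt0. Qed.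
Let Lf_gt0 : 0 < Lf. Proof. exact: L_obj_gt0. Qed.

Lemma past_mono i k : (i <= k)%N -> {subset @past _ pb i <= @past _ pb k}.
Proof.
elim: k => [|k IH]; first by rewrite leqn0 => /eqP ->.
rewrite leq_eqVlt => /predU1P[->//|]; rewrite ltnS => /IH h s /h sk.
by rewrite /= !in_cons mem_cat sk !orbT.
Qed.

Lemma total_weight_gt0 k : 0 < total_weight a k.
Proof.
rewrite /total_weight big_ord_recl ltr_wpDr ?weight_gt0// sumr_ge0// => i _.
by rewrite ltW// weight_gt0.
Qed.

(** Jensen's inequality through the tangent at [xbar]: the weighted deviations from [xbar] sum to
    zero, so the linear terms disappear. *)
Lemma expected_gap_le_avg k : (expected_gap a k <=
  ((total_weight a k)^-1 * \sum_(i < k.+1) weight a i * gap_pos a i)%:E)%E.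
Proof.
have W0 := total_weight_gt0 k.
have sx i : (i <= k)%N -> sq P (@events _ _ a) (past k) (@pos _ _ a i).
  by move=> ik; have [+ _ _ _] := sq_run a i; apply: sq_sub; exact: past_mono.
have sbar : sq P (@events _ _ a) (past k) (@xbar _ _ a k).
  apply: sqZ; apply: (sq_sum (@events_measurable _ _ a)) => i; apply: sqZ.
  by apply: sx; rewrite -ltnS.
have g1 i : L1 P (fun w => weight a i * gap (@pos _ _ a i w)).
  by apply: L1Z; exact: L1_gap_pos.
have b1 : L1 P (fun w => gap (xbar k w)).
  exact: (L1_gap (@events_measurable _ _ a) (L_obj_gt0 pb) (obj_smooth pb) (@xstar_min _ pb) sbar).
rewrite /expected_gap unlock -/(gap _) (integral_Ex b1) lee_fin.
have S1 : L1 P (fun w => \sum_(i < k.+1) weight a i * gap (@pos _ _ a i w)) by exact: L1_sum.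
have -> : \sum_(i < k.+1) weight a i * gap_pos a i =
    Ex P (fun w => \sum_(i < k.+1) weight a i * gap (@pos _ _ a i w)).
  by rewrite Ex_sum//; apply: eq_bigr => i _; rewrite ExZ//; exact: L1_gap_pos.
rewrite -ExZ//; apply: Ex_le => //; first exact: L1Z.
move=> w; rewrite ler_pdivlMl//.
have -> : total_weight a k * gap (xbar k w) = \sum_(i < k.+1) weight a i *
    (gap (xbar k w) + dot (grad (@obj _ pb) (xbar k w)) (pos i w - xbar k w)).
  under eq_bigr do rewrite mulrDr -dotZr.
  rewrite big_split/= -mulr_suml -dot_sumr.
  have -> : \sum_(i < k.+1) weight a i *: (pos i w - xbar k w) = 0; last by rewrite dot0r addr0.
  under eq_bigr do rewrite scalerBr.
  rewrite sumrB -scaler_suml -/(total_weight a k) /xbar scalerA divff ?scale1r ?subrr//.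
  by rewrite gt_eqF.
apply: ler_sum => i _; rewrite ler_pM2l ?weight_gt0//.
by have := obj_convex (xbar k w) (pos i w); rewrite /gap; lra.
Qed.

Lemma lyapunov0 : lyapunov a 0 = init_dist a
  + coef_offset a * (n^-1 * init_shift a) + coef_ref a * init_gap a.
Proof.
have -> : lyapunov a 0 = dist2 a 0 + coef_err a * err2 a 0
  + coef_offset a * offset2 a 0 + coef_ref a * gap_ref a 0 by [].
have -> : dist2 a 0 = init_dist a.
  rewrite /init_dist enorm_sqr -[RHS](Ex_cst P); apply: eq_Ex => w.
  rewrite /virtual (_ : avg _ = 0) ?subr0//.
  by rewrite /avg big1 ?scaler0.
have -> : err2 a 0 = 0.
  rewrite /err2 big1 ?mulr0// => t _; rewrite -[RHS](Ex_cst P); apply: eq_Ex => w.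
  by rewrite dot0l.
have -> : offset2 a 0 = n^-1 * init_shift a.
  congr (_ * _); apply: eq_bigr => t _.
  by rewrite enorm_sqr -[RHS](Ex_cst P); apply: eq_Ex.
have -> : gap_ref a 0 = init_gap a by rewrite -[RHS](Ex_cst P); apply: eq_Ex.
by rewrite mulr0 addr0.
Qed.

Lemma init_dist_ge0 : 0 <= init_dist a. Proof. exact: sqr_ge0. Qed.
Lemma init_gap_ge0 : 0 <= init_gap a. Proof. exact: gap_ge0. Qed.
Lemma init_shift_ge0 : 0 <= init_shift a.
Proof. by apply: sumr_ge0 => t _; exact: sqr_ge0. Qed.

Let avg_shift_ge0 : 0 <= n^-1 * init_shift a.
Proof. by rewrite mulr_ge0 ?init_shift_ge0// invr_ge0 ler0n. Qed.

Hypothesis small : small_stepsize a.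

Lemma expected_gap_le k : (expected_gap a k <=
  (2 / eta * ((1 - rho a) * lyapunov a 0) / total_weight a k)%:E)%E.
Proof.
apply: le_trans (expected_gap_le_avg k) _; rewrite lee_fin mulrC.
rewrite ler_pM2r ?invr_gt0 ?total_weight_gt0//.
have -> : 2 / eta = (eta / 2)^-1 by rewrite invf_div.
rewrite ler_pdivlMl ?divr_gt0//; apply: le_trans (weighted_gap_sum small k.+1).
by rewrite lerDl !mulr_ge0 ?lyapunov_ge0 ?ltW ?weight_gt0// subr_gt0 rho_lt1.
Qed.

Lemma gap_gain_third : gap_gain a <= eta / 3.
Proof.
apply: le_trans (gap_gain_le small) _; rewrite ler_pM2l//.
have [hA _ _ _] := small.
have : 4 * (eta * Lf) + 33 * (eta * L / n) <= 1.
  by apply: le_trans hA; rewrite le_eqVlt; apply/orP; left; apply/eqP; ring.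
have : 0 < eta * Lf by exact: mulr_gt0.
move: (eta * Lf) (eta * L / n) => u v; lra.
Qed.

Lemma coef_offsetE :
  coef_offset a = 320 * eta * ((1 - de) * Lf * eta ^+ 2 / (de ^+ 2 * d1)).
Proof. by rewrite /coef_offset /coef_err; field; rewrite !gt_eqF. Qed.

(** Here [rho <= d1 / 4] removes [d1] from the denominator, so the condition with constant 60
    suffices: [160 / 3600 < 1 / 15]. *)
Lemma coef_offset_rho : 2 / eta * rho a * coef_offset a <= 1 / (15 * Lb).
Proof.
have [_ hB _ _] := small; have [_ _ rd1 _] := rho_bounds a.
have c0 := coef_offset_ge0 a.
apply: (@le_trans _ _ (2 / eta * (d1 / 4) * coef_offset a)).
  by rewrite ler_wpM2r// ler_pM2l ?divr_gt0.
have -> : 2 / eta * (d1 / 4) * coef_offset a = 160 * ((1 - de) * Lf * eta ^+ 2 / de ^+ 2).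
  by rewrite coef_offsetE; field; rewrite !gt_eqF.
have z1 : 0 < de ^+ 2 by exact: exprn_gt0.
have : (1 - de) * Lf * eta ^+ 2 / de ^+ 2 <= 1 / (3600 * Lb).
  have c1 : 0 < 3600 :> R by exact: ltr0Sn.
  apply: (le_div_of (mulr_gt0 c1 Lb_gt0) z1).
  by apply: le_trans hB; rewrite le_eqVlt; apply/orP; left; apply/eqP; ring.
move: (_ / de ^+ 2) => z; rewrite !div1r !invfM.
have : 0 < Lb^-1 by rewrite invr_gt0.
move: (Lb^-1) => l; lra.
Qed.

(** Without [rho] to cancel [d1], the condition with constant 120 is used, after bounding
    [1 + 2 * p / d1] below by 1: [640 / 14400 < 1 / 3]. *)
Lemma coef_offset_le : 2 / eta * coef_offset a <= 1 / (3 * Lb * p).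
Proof.
have [_ _ _ hD] := small.
have -> : 2 / eta * coef_offset a = 640 * ((1 - de) * Lf * eta ^+ 2 / (de ^+ 2 * d1)).
  by rewrite coef_offsetE; field; rewrite !gt_eqF.
have z1 : 0 < de ^+ 2 * d1 by rewrite mulr_gt0// exprn_gt0.
have : (1 - de) * Lf * eta ^+ 2 / (de ^+ 2 * d1) <= 1 / (14400 * (Lb * p)).
  have c1 : 0 < 14400 :> R by exact: ltr0Sn.
  apply: (le_div_of (mulr_gt0 c1 (mulr_gt0 Lb_gt0 p_gt0)) z1).
  apply: le_trans hD.
  have -> : 14400 * (Lb * p) * ((1 - de) * Lf) * eta ^+ 2
    = 14400 * ((1 - de) * Lf * Lb * p) * eta ^+ 2 by ring.
  have q0 : 0 <= 2 * p / d1 by rewrite ltW// divr_gt0// mulr_gt0.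
  have s0 : 0 <= (1 - de) * Lf * Lb * p by rewrite !mulr_ge0 ?subr_ge0// ltW.
  rewrite ler_wpM2r ?sqr_ge0// (ler_pM2l c1).
  by rewrite ler_peMr// lerDl.
move: (_ / (de ^+ 2 * d1)) => z; rewrite -[3 * _ * _]mulrA !div1r !invfM.
have : 0 < Lb^-1 / p by rewrite divr_gt0// invr_gt0.
move: (Lb^-1 / p) => l; lra.
Qed.

Lemma coef_ref_le : 2 / eta * coef_ref a <= 6 / p.
Proof.
have -> : 2 / eta * coef_ref a = 8 / (3 * eta * p) * gap_gain a.
  by rewrite /coef_ref; field; rewrite !gt_eqF.
apply: (@le_trans _ _ (8 / (3 * eta * p) * (eta / 3))).
  by rewrite ler_pM2l ?gap_gain_third// divr_gt0// !mulr_gt0.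
have -> : 8 / (3 * eta * p) * (eta / 3) = 8 / 9 / p by field; rewrite !gt_eqF.
by rewrite ler_pM2r ?invr_gt0//; lra.
Qed.

Lemma coef_ref_rho : 2 / eta * rho a * coef_ref a <= 2.
Proof.
have [_ _ _ rp] := rho_bounds a; have c0 := coef_ref_ge0 a.
apply: (@le_trans _ _ (p / 4 * (2 / eta * coef_ref a))).
  have -> : 2 / eta * rho a * coef_ref a = rho a * (2 / eta * coef_ref a) by ring.
  by apply: ler_wpM2r => //; apply: mulr_ge0 => //; apply: divr_ge0 => //; exact: ltW.
apply: (@le_trans _ _ (p / 4 * (6 / p))); first by rewrite ler_pM2l ?coef_ref_le ?divr_gt0.
have -> : p / 4 * (6 / p) = 3 / 2 by field; rewrite gt_eqF.
lra.
Qed.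

Lemma rho_lyapunov0 : 2 / eta * rho a * lyapunov a 0 <= Delta0 a.
Proof.
have [rm _ _ _] := rho_bounds a.
rewrite lyapunov0 /Delta0; move: (init_gap a) init_gap_ge0 => g g0; rewrite !mulrDr -addrA [leRHS]addrAC -[leRHS]addrA.
apply: lerD; last apply: lerD.
- rewrite ler_wpM2r ?init_dist_ge0//.
  apply: (@le_trans _ _ (2 / eta * (mu pb * eta / 2))); first by rewrite ler_pM2l ?divr_gt0.
  have -> : 2 / eta * (mu pb * eta / 2) = mu pb by field; rewrite gt_eqF.
  by have := mu_ge0 pb; lra.
- rewrite mulrA [leRHS](_ : _ = 1 / (15 * Lb) * (n^-1 * init_shift a)); last first.
    by field; rewrite !gt_eqF.
  by apply: ler_wpM2r; [exact: avg_shift_ge0|exact: coef_offset_rho].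
- by rewrite mulrA ler_wpM2r ?coef_ref_rho.
Qed.

Lemma rate_strongly_convex : 0 < mu pb -> forall k,
  (expected_gap a k
     <= (Delta0 a / (1 - (1 - rho a) ^+ k.+1) * (1 - rho a) ^+ k)%:E)%E.
Proof.
move=> mu0 k; apply: le_trans (expected_gap_le k) _; rewrite lee_fin.
have r0 : 0 < rho a by rewrite /rho !lt_min !divr_gt0 ?mulr_gt0.
have q0 : 0 < 1 - rho a by rewrite subr_gt0 rho_lt1.
have q1 : 1 - rho a < 1 by rewrite ltrBlDr ltrDl.
have qk : 0 < 1 - (1 - rho a) ^+ k.+1.
  by rewrite subr_gt0 exprn_ilt1// ltW.
(* Geometric sum of the weights; it produces the denominator of the claimed rate. *)
have WE : rho a * total_weight a k = (1 - (1 - rho a) ^+ k.+1) / (1 - rho a) ^+ k.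
  rewrite /total_weight; elim: k {qk} => [|k IH].
    by rewrite big_ord_recl big_ord0 addr0 /weight !expr0 expr1 invr1; ring.
  rewrite big_ord_recr/= mulrDr IH /weight !exprS; field.
  by rewrite !gt_eqF ?exprn_gt0.
have -> : 2 / eta * ((1 - rho a) * lyapunov a 0) / total_weight a k =
    (1 - rho a) * (2 / eta * rho a * lyapunov a 0) / (rho a * total_weight a k).
  by field; rewrite !gt_eqF// total_weight_gt0.
have -> : Delta0 a / (1 - (1 - rho a) ^+ k.+1) * (1 - rho a) ^+ k
    = Delta0 a / (rho a * total_weight a k).
  by rewrite WE invf_div mulrA mulrAC.
have D0 := rho_lyapunov0.
rewrite ler_pM2r ?invr_gt0 ?mulr_gt0 ?total_weight_gt0//; apply: le_trans D0.
have l0 : 0 <= 2 / eta * rho a * lyapunov a 0.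
  apply: mulr_ge0; last exact: lyapunov_ge0.
  by apply: mulr_ge0; [apply: divr_ge0 => //; exact: ltW|exact: ltW].
by apply: ler_piMl => //; exact: ltW.
Qed.

Lemma rate_convex : mu pb = 0 -> forall k, (expected_gap a k <=
  (1 / k.+1%:R * (18 / eta * init_dist a
     + 1 / (3 * Lb * p * n) * init_shift a + 6 / p * init_gap a))%:E)%E.
Proof.
move=> mu0 k; apply: le_trans (expected_gap_le k) _; rewrite lee_fin.
have r0 : rho a = 0.
  apply/eqP; rewrite eq_le rho_ge0 andbT; have [rm _ _ _] := rho_bounds a.
  by move: rm; rewrite mu0 !mul0r.
(* With [mu = 0] the parameter [rho] is zero and all weights are 1. *)
have -> : total_weight a k = k.+1%:R.
  rewrite /total_weight /weight r0 subr0.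
  under eq_bigr do rewrite expr1n invr1.
  by rewrite sumr_const card_ord.
rewrite r0 subr0 mul1r mulrC div1r ler_pM2l ?invr_gt0 ?ltr0n//.
rewrite lyapunov0; move: (init_gap a) init_gap_ge0 => g g0; rewrite !mulrDr; apply: lerD; first apply: lerD.
- rewrite ler_wpM2r ?init_dist_ge0// ler_pM2r ?invr_gt0//; lra.
- rewrite mulrA [leRHS](_ : _ = 1 / (3 * Lb * p) * (n^-1 * init_shift a)); last first.
    by field; rewrite !gt_eqF.
  by apply: ler_wpM2r; [exact: avg_shift_ge0|exact: coef_offset_le].
- by rewrite mulrA ler_wpM2r ?coef_ref_le.
Qed.

End rates.

(** * Iteration complexity *)

Lemma min4_cases {disp : Order.disp_t} {T : orderType disp} (x y1 y2 y3 y4 : T) :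
  x = Order.min y1 (Order.min y2 (Order.min y3 y4)) ->
  [\/ x = y1, x = y2, x = y3 | x = y4].
Proof.
rewrite !minElt => ->; case: ifP => _; first by constructor 1.
case: ifP => _; first by constructor 2.
by case: ifP => _; [constructor 3|constructor 4].
Qed.

Section complexity.
Context {R : realType} {pb : problem R} (a : ec_lsvrg pb) (c : R).
Local Notation eta := (stepsize a).
Local Notation p := (p_coin a).
Local Notation de := (delta a).
Local Notation d1 := (delta1 a).
Local Notation L := (L_item pb).
Local Notation Lb := (L_node pb).
Local Notation Lf := (L_obj pb).
Local Notation n := ((nodes pb)%:R : R).
Local Notation s1 := (Num.sqrt ((1 - de) * Lf * Lb)).
Local Notation s2 := (Num.sqrt ((1 - de) * Lf * L)).

Hypothesis c_gt0 : 0 < c.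
Hypothesis etaE : eta%:E = eta_max a.
Hypothesis p_le : p <= c * d1.

(** The 64 dominates the constants 4, 33, 60 and 64 of the first three entries of [eta_max]; the
    other term is for the fourth. *)
Definition stepsize_const : R := 64 + 120 * Num.sqrt (c * (1 + 2 * c)).

Let n_gt0 : 0 < n. Proof. by rewrite ltr0n; exact: nodes_gt0. Qed.
Let eta_gt0 : 0 < eta. Proof. exact: stepsize_gt0. Qed.
Let p_gt0 : 0 < p. Proof. by have /andP[] := p_coin_range a. Qed.
Let de_gt0 : 0 < de. Proof. by have [/andP[]] := Q_compressor a. Qed.
Let de_le1 : de <= 1. Proof. by have [/andP[]] := Q_compressor a. Qed.
Let d1_gt0 : 0 < d1. Proof. by have [/andP[]] := Q1_compressor a. Qed.
Let L_gt0 : 0 < L. Proof. exact: L_item_gt0. Qed.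
Let Lb_gt0 : 0 < Lb. Proof. exact: L_node_gt0. Qed.
Let Lf_gt0 : 0 < Lf. Proof. exact: L_obj_gt0. Qed.
Let s1_ge0 : 0 <= s1 / de. Proof. by rewrite divr_ge0 ?sqrtr_ge0// ltW. Qed.
Let s2_ge0 : 0 <= s2 / Num.sqrt de. Proof. by rewrite divr_ge0 ?sqrtr_ge0. Qed.
Let Ln_gt0 : 0 < L / n. Proof. exact: divr_gt0. Qed.

Lemma small_of_max : small_stepsize a.
Proof. by apply: eta_max_small; rewrite etaE. Qed.

Let inv_of_div (q r : R) : 0 < q -> eta%:E = (q%:E / r%:E)%E -> eta^-1 = r / q.
Proof.
move=> q0; have [->|rn] := eqVneq r 0.
  by rewrite inver eqxx gt0_muley ?lte_fin.
by rewrite inver (negbTE rn) -EFinM => -[->]; rewrite invf_div.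
Qed.

(** The inverse stepsize is the reciprocal of one of the four entries. In the fourth, [p / d1 <= c]
    bounds [p * (1 + 2 * p / d1)] by [c * (1 + 2 * c) * d1], whose root cancels [sqrt d1]. *)
Lemma inv_stepsize_le : eta^-1 <=
  stepsize_const * (Lf + L / n + s1 / de + s2 / Num.sqrt de).
Proof.
set S := Lf + _ + _ + _; pose q := Num.sqrt (c * (1 + 2 * c)).
have q0 : 0 <= q by exact: sqrtr_ge0.
have S0 : 0 <= S by rewrite /S; move: s1_ge0 s2_ge0 Ln_gt0 Lf_gt0; lra.
have S64 : 64 * S <= stepsize_const * S.
  by apply: ler_wpM2r => //; rewrite /stepsize_const -/q; lra.
have S120 : 120 * q * S <= stepsize_const * S.
  by apply: ler_wpM2r => //; rewrite /stepsize_const -/q; lra.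
have [|||] := min4_cases etaE.
- move=> /(inv_of_div ltr01) ->; rewrite divr1; apply: le_trans S64.
  by rewrite /S -[33 * L / n]mulrA; move: s1_ge0 s2_ge0 Ln_gt0 Lf_gt0; lra.
- move=> /(inv_of_div de_gt0) ->; apply: le_trans S64.
  by rewrite /S -?[leLHS]mulrA; move: s1_ge0 s2_ge0 Ln_gt0 Lf_gt0; lra.
- have sd0 : 0 < Num.sqrt de by rewrite sqrtr_gt0.
  move=> /(inv_of_div sd0) ->; apply: le_trans S64.
  by rewrite /S -?[leLHS]mulrA; move: s1_ge0 s2_ge0 Ln_gt0 Lf_gt0; lra.
have sd1 : 0 < Num.sqrt d1 by rewrite sqrtr_gt0.
move=> /(inv_of_div (mulr_gt0 de_gt0 sd1)) ->; apply: le_trans S120.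
apply: (@le_trans _ _ (120 * q * (s1 / de))); last first.
  apply: ler_wpM2l; first by rewrite mulr_ge0.
  by rewrite /S; move: s1_ge0 s2_ge0 Ln_gt0 Lf_gt0; lra.
have r0 : 0 <= (1 - de) * Lf * Lb by rewrite !mulr_ge0 ?subr_ge0// ltW.
have pd : p / d1 <= c by rewrite ler_pdivrMr.
have pd0 : 0 <= p / d1 by rewrite divr_ge0// ltW.
have le : Num.sqrt ((1 - de) * Lf * Lb * p * (1 + 2 * p / d1)) <= s1 * (q * Num.sqrt d1).
  have c1 : 0 <= c * (1 + 2 * c) by apply: mulr_ge0; [exact: ltW|move: c_gt0; lra].
  rewrite /q -!sqrtrM//; apply: ler_wsqrtr; rewrite -mulrA; apply: ler_wpM2l => //.
  have -> : c * (1 + 2 * c) * d1 = c * d1 * (1 + 2 * c) by ring.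
  apply: ler_pM => //; [exact: ltW|by rewrite -mulrA; move: pd0; lra|].
  by rewrite -mulrA; move: pd; lra.
have -> : 120 * q * (s1 / de) = 120 * (s1 * (q * Num.sqrt d1)) / (de * Num.sqrt d1).
  by field; rewrite !gt_eqF.
by apply: ler_wpM2r; [rewrite invr_ge0 ltW// mulr_gt0|exact: ler_wpM2l].
Qed.

Definition rate_const : R := 2 * stepsize_const + 8 + 4 * c.

Lemma stepsize_const_ge0 : 0 <= stepsize_const.
Proof. by have := sqrtr_ge0 (c * (1 + 2 * c)); rewrite /stepsize_const; lra. Qed.

Lemma inv_rho_le : 0 < mu pb -> (rho a)^-1 <= rate_const * rate_sc a.
Proof.
move=> mu0; have K0 := stepsize_const_ge0.
set T := (Lf + L / n + s1 / de + s2 / Num.sqrt de) / mu pb.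
have rE : rate_sc a = de^-1 + p^-1 + T.
  rewrite /rate_sc /T; have sd0 : 0 < Num.sqrt de by rewrite sqrtr_gt0.
  by field; rewrite !gt_eqF.
have T0 : 0 <= T.
  apply: divr_ge0; last exact: ltW.
  by move: s1_ge0 s2_ge0 Ln_gt0 Lf_gt0; lra.
have de0 : 0 < de^-1 by rewrite invr_gt0.
have p0 : 0 < p^-1 by rewrite invr_gt0.
have h1 : (mu pb * eta / 2)^-1 <= 2 * stepsize_const * T.
  have -> : (mu pb * eta / 2)^-1 = 2 / mu pb * eta^-1 by field; rewrite !gt_eqF.
  have -> : 2 * stepsize_const * T = 2 / mu pb * (stepsize_const *
    (Lf + L / n + s1 / de + s2 / Num.sqrt de)) by rewrite /T; ring.
  by rewrite ler_pM2l ?divr_gt0//; exact: inv_stepsize_le.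
(* The assumption on [p] is what lets [1 / p] stand for [1 / d1] in the complexity. *)
have h3 : (d1 / 4)^-1 <= 4 * c * p^-1.
  rewrite invf_div ler_pdivrMr// mulrAC ler_pdivlMr//; move: p_le; lra.
have [e1 e2 e3] : [/\ (de / 4)^-1 = 4 * de^-1, (p / 4)^-1 = 4 * p^-1 & 0 < 4 * c].
  by rewrite !invf_div; split => //; rewrite mulr_gt0.
have C1 : 2 * stepsize_const * T <= rate_const * T.
  by apply: ler_wpM2r => //; rewrite /rate_const; lra.
have C2 : 4 * de^-1 <= rate_const * de^-1.
  by rewrite ler_pM2r// /rate_const; lra.
have C3 : (4 + 4 * c) * p^-1 <= rate_const * p^-1.
  by rewrite ler_pM2r// /rate_const; lra.
have cp : 0 < 4 * c * p^-1 by exact: mulr_gt0.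
have KT : 0 <= 2 * stepsize_const * T by apply: mulr_ge0 => //; exact: mulr_ge0.
rewrite rE !mulrDr.
have [|||] := @min4_cases _ R (rho a) _ _ _ _ erefl => ->.
- by lra.
- by rewrite e1; lra.
- by lra.
- by rewrite e2; lra.
Qed.

Lemma complexity_strongly_convex (D eps : R) k : 0 < mu pb ->
  0 < D -> Delta0 a <= D -> 0 < eps -> eps <= Delta0 a ->
  (rate_const * ln (1 / eps) + (rate_const * `|ln (2 * D)| + 1)) * rate_sc a <= k%:R ->
  (expected_gap a k <= eps%:E)%E.
Proof.
move=> mu0 D0 DD e0 eD hk.
apply: le_trans (rate_strongly_convex small_of_max mu0 k) _; rewrite lee_fin.
have r0 : 0 < rho a by rewrite /rho !lt_min !divr_gt0 ?mulr_gt0.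
have Del0 : 0 < Delta0 a by exact: lt_le_trans eD.
have inv0 : 0 < (rho a)^-1 by rewrite invr_gt0.
have iR := inv_rho_le mu0.
have K0 : 0 < rate_const.
  by have := stepsize_const_ge0; move: c_gt0; rewrite /rate_const; lra.
have R0 : 0 < rate_sc a by rewrite -(pmulr_rgt0 _ K0); exact: lt_le_trans iR.
(* The target is [(1 - rho) ^+ k <= eps / (2 * Delta0)]; the factor 2 pays for the denominator of
   the rate, which is then at least [1 / 2]. *)
pose X := ln (2 * Delta0 a / eps).
have X0 : 0 < X by rewrite ln_gt0// ltr_pdivlMr//; lra.
have XE : X = ln (1 / eps) + ln (2 * Delta0 a).
  by rewrite -lnM ?posrE ?divr_gt0 ?mulr_gt0//; congr ln; field; rewrite gt_eqF.
(* The absolute value allows for [D] below [1 / 2], where the logarithm is negative. *)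
have lnD : ln (2 * Delta0 a) <= `|ln (2 * D)|.
  apply: le_trans (ler_norm _); rewrite ler_ln ?posrE ?mulr_gt0//; lra.
have hX : X <= rho a * k%:R.
  rewrite -ler_pdivrMl//; apply: le_trans hk.
  apply: (@le_trans _ _ (rate_const * rate_sc a * X)); first by rewrite ler_pM2r.
  rewrite mulrAC ler_pM2r// XE mulrDr lerD2l.
  by apply: (@le_trans _ _ (rate_const * `|ln (2 * D)|)); [rewrite ler_pM2l|lra].
have q0 : 0 < 1 - rho a by rewrite subr_gt0 rho_lt1.
have qk : (1 - rho a) ^+ k <= eps / (2 * Delta0 a).
  have -> : eps / (2 * Delta0 a) = expR (- X).
    by rewrite expRN lnK ?posrE ?divr_gt0 ?mulr_gt0// invf_div.
  apply: (@le_trans _ _ (expR (- rho a) ^+ k)).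
    apply: lerXn2r; rewrite ?nnegrE ?expR_ge0//; first exact: ltW.
    exact: expR_ge1Dx.
  rewrite -expRM_natl ler_expR; move: hX; lra.
have qk1 : (1 - rho a) ^+ k.+1 <= 1 / 2.
  rewrite exprS; apply: (@le_trans _ _ (1 * (eps / (2 * Delta0 a)))).
    by apply: ler_pM => //; rewrite ?exprn_ge0 ?ltW//; lra.
  by rewrite mul1r ler_pdivrMr ?mulr_gt0//; lra.
rewrite mulrAC ler_pdivrMr; last by lra.
apply: (@le_trans _ _ (Delta0 a * (eps / (2 * Delta0 a)))); first by rewrite ler_pM2l.
have -> : Delta0 a * (eps / (2 * Delta0 a)) = eps * (1 / 2) by field; rewrite gt_eqF.
by rewrite ler_pM2l//; lra.
Qed.

(** The stepsize enters through [18 / eta], and the 7 dominates [6 + 1 / 3], the coefficients of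
    [1 / p] from the initial gap and the shifts. *)
Lemma complexity_convex (D eps : R) k : 0 < D -> mu pb = 0 ->
  init_dist a <= D -> init_gap a <= D ->
  1 / (Lb * n) * init_shift a <= D -> 0 < eps ->
  (18 * stepsize_const + 7) * D * (rate_c a * (1 / eps)) <= k%:R ->
  (expected_gap a k <= eps%:E)%E.
Proof.
move=> D0 mu0 hd hg hs e0 hk.
apply: le_trans (rate_convex small_of_max mu0 k) _; rewrite lee_fin div1r.
rewrite ler_pdivrMl ?ltr0n//.
have K0 := stepsize_const_ge0; have p0 : 0 < p^-1 by rewrite invr_gt0.
set S := Lf + L / n + s1 / de + s2 / Num.sqrt de.
have S0 : 0 <= S by move: s1_ge0 s2_ge0 Ln_gt0 Lf_gt0; rewrite /S; lra.
have rE : rate_c a = p^-1 + S by rewrite /rate_c /S !addrA.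
have h1 : 18 / eta * init_dist a <= 18 * stepsize_const * S * D.
  apply: ler_pM => //; [by rewrite divr_ge0// ltW|exact: init_dist_ge0|].
  by rewrite -mulrA ler_pM2l//; exact: inv_stepsize_le.
have h2 : 1 / (3 * Lb * p * n) * init_shift a <= 1 / 3 * p^-1 * D.
  have -> : 1 / (3 * Lb * p * n) * init_shift a = 1 / 3 * p^-1 * (1 / (Lb * n) * init_shift a).
    by field; rewrite !gt_eqF.
  by rewrite ler_pM2l// mulr_gt0.
have h3 : 6 / p * init_gap a <= 6 * p^-1 * D by rewrite ler_pM2l// mulr_gt0.
have hR : (18 * stepsize_const + 7) * D * rate_c a <= k%:R * eps.
  by rewrite -ler_pdivrMr//; move: hk; rewrite div1r mulrA.
apply: (@le_trans _ _ (k%:R * eps)).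
  apply: le_trans hR; rewrite rE.
  have : 0 <= stepsize_const * p^-1 * D.
    by apply: mulr_ge0; [apply: mulr_ge0 => //|]; exact: ltW.
  have : 0 <= S * D by rewrite mulr_ge0// ltW.
  have : 0 <= p^-1 * D by rewrite mulr_ge0// ltW.
  lra.
by rewrite ler_pM2r// ler_nat.
Qed.

End complexity.

Unset Implicit Arguments.
Set Strict Implicit.

(* (ii): the constant hidden in p <= O(delta1) is c, the one hidden in
   k >= O(_) is C. For mu > 0 the bound is O(ln (1/epsilon)) as epsilon -> 0:
   C depends on c only, and the lower order term B also on a bound D on Delta0.
   (Without B the claim fails for epsilon = 1 <= Delta0, where ln (1/epsilon)
   vanishes.) For mu = 0 the constant C also depends on a bound D on the
   initial data. *)
Theorem theorem2p10 (R : realType) :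
  (forall (pb : problem R) (a : ec_lsvrg pb),
    ((stepsize a)%:E <= eta_max a)%E ->
    (0 < mu pb -> forall k : nat,
      (expected_gap a k
        <= (Delta0 a / (1 - (1 - rho a) ^+ k.+1) * (1 - rho a) ^+ k)%:E)%E) /\
    (mu pb = 0 -> forall k : nat,
      (expected_gap a k
        <= (1 / k.+1%:R *
             (18 / stepsize a * init_dist a
              + 1 / (3 * L_node pb * p_coin a * (nodes pb)%:R) * init_shift a
              + 6 / p_coin a * init_gap a))%:E)%E)) /\
  (forall c : R, 0 < c ->
    (exists2 C : R, 0 < C &
      forall D : R, 0 < D -> exists2 B : R, 0 < B &
        forall (pb : problem R) (a : ec_lsvrg pb),
          (stepsize a)%:E = eta_max a -> p_coin a <= c * delta1 a ->
          0 < mu pb -> Delta0 a <= D ->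
          forall eps : R, 0 < eps -> eps <= Delta0 a ->
          forall k : nat,
            (C * ln (1 / eps) + B) * rate_sc a <= k%:R ->
            (expected_gap a k <= eps%:E)%E) /\
    (forall D : R, 0 < D -> exists2 C : R, 0 < C &
        forall (pb : problem R) (a : ec_lsvrg pb),
          (stepsize a)%:E = eta_max a -> p_coin a <= c * delta1 a ->
          mu pb = 0 ->
          init_dist a <= D -> init_gap a <= D ->
          1 / (L_node pb * (nodes pb)%:R) * init_shift a <= D ->
          forall eps : R, 0 < eps ->
          forall k : nat,
            C * (rate_c a * (1 / eps)) <= k%:R ->
            (expected_gap a k <= eps%:E)%E)).
Proof.
split=> [pb a ha|c c0].
  have small := eta_max_small ha.
  split=> [mu0 k|mu0 k]; first exact: rate_strongly_convex.
  exact: rate_convex.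
have K0 := stepsize_const_ge0 c.
split.
  have C0 : 0 < rate_const c by rewrite /rate_const; lra.
  exists (rate_const c) => // D D0.
  (* The added 1 keeps the witness positive when [ln (2 * D)] vanishes. *)
  exists (rate_const c * `|ln (2 * D)| + 1).
    by rewrite ltr_wpDl// mulr_ge0// ltW.
  move=> pb a etaE pc mu0 DD eps e0 eD k.
  exact: (complexity_strongly_convex c0 etaE pc mu0 D0 DD e0 eD).
move=> D D0; exists ((18 * stepsize_const c + 7) * D).
  by rewrite mulr_gt0//; lra.
move=> pb a etaE pc mu0 hd hg hs eps e0 k.
exact: (complexity_convex c0 etaE pc D0 mu0 hd hg hs e0).
Qed.
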